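(* Let $0\le s<r<1$ and $\lambda\in\mathbb{C}$ with $|\lambda|<1$. With $V(r,s,\lambda)$, $A,B,C,\eta,t,c(\cdot),\rho(\cdot),t_\theta,\zeta_\theta$ as defined in the context, $V(r,s,\lambda)$ is a convex closed domain enclosed by the Jordan curve $\partial V(r,s,\lambda)$, and a parametric representation $(-\pi,\pi]\ni\theta\mapsto\gamma(\theta)$ of $\partial V(r,s,\lambda)$ is given as follows. (i) If $t+|\eta|\le\frac12$, then $|te^{i\theta}-\overline{\eta}|\ge 2(t^2-|\eta|^2)$ for all $\theta\in\mathbb{R}$ and $$\gamma(\theta)=A\big(B+C\,c(\zeta_\theta)\big)\in\partial V(r,s,\lambda).$$ (ii) If $t-|\eta|\ge\frac12$, then $|te^{i\theta}-\overline{\eta}|\le 2(t^2-|\eta|^2)$ for all $\theta\in\mathbb{R}$ and $$\gamma(\theta)=A\big(B+C(c(\zeta_\theta)+\rho(\zeta_\theta)e^{i\theta})\big)\in\partial V(r,s,\lambda).$$ (iii) If $t+|\eta|>\frac12$ and $t-|\eta|<\frac12$, then $$\gamma(\theta)=\begin{cases}A\big(B+C(c(\zeta_\theta)+\rho(\zeta_\theta)e^{i\theta})\big), & |te^{i\theta}-\overline{\eta}|<2(t^2-|\eta|^2),\\ A\big(B+C\,c(\zeta_\theta)\big), & |te^{i\theta}-\overline{\eta}|\ge 2(t^2-|\eta|^2).\end{cases}$$ Furthermore, let $f\in\mathcal{H}_0(r,s,\lambda)$. For $\theta\in\mathbb{R}$ with $\zeta_\theta\in\mathbb{D}$, $$f'''(r)=A\big(B+C(c(\zeta_\theta)+\rho(\zeta_\theta)e^{i\theta})\big)\in\partial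 V(r,s,\lambda)$$ if and only if $$f(z)=z\,T_{\frac{s}{r}}\Big(T_{-r}(z)\,T_\lambda\big(T_{-r}(z)\,T_{\zeta_\theta}(e^{i(\theta+\arg C)}T_{-r}(z))\big)\Big),\quad z\in\mathbb{D}.$$ Similarly, for $\theta\in\mathbb{R}$ with $\zeta_\theta\in\partial\mathbb{D}$, $$f'''(r)=A\big(B+C\,c(\zeta_\theta)\big)\in\partial V(r,s,\lambda)$$ if and only if $$f(z)=z\,T_{\frac{s}{r}}\big(T_{-r}(z)\,T_\lambda(\zeta_\theta T_{-r}(z))\big),\quad z\in\mathbb{D}.$$
   Context: $\mathbb{D}=\{z\in\mathbb{C}:|z|<1\}$ is the open unit disk; $\mathcal{H}_0$ is the set of all analytic maps $f:\mathbb{D}\to\mathbb{D}$ with $f(0)=0$. For $a\in\mathbb{D}$, $T_a(z)=\dfrac{z+a}{1+\overline{a}z}$. For $0\le s<r<1$ and $\lambda\in\mathbb{D}$: $$\mathcal{H}_0(r,s,\lambda)=\Big\{f\in\mathcal{H}_0: f(r)=s,\ f'(r)=\frac{s}{r}+\frac{r^2-s^2}{r(1-r^2)}\lambda\Big\},\qquad V(r,s,\lambda)=\{f'''(r): f\in\mathcal{H}_0(r,s,\lambda)\}\subset\mathbb{C}.$$ Constants: $$A=\frac{6(r^2-s^2)}{r^3(1-r^2)^3},\quad B=s^2\lambda^3-s(1+r^2)\lambda^2+r^2\lambda,\quad C=r(1-|\lambda|^2)(1+r^2-2s\lambda),$$ $$\eta=\frac{r\overline{\lambda}}{1+r^2-2s\lambda},\qquad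 t=\frac{r}{|1+r^2-2s\lambda|}.$$ Functions on $\overline{\mathbb{D}}$: $c(\zeta)=\zeta(1-\eta\zeta)$ and $\rho(\zeta)=t(1-|\zeta|^2)$. For $\theta\in\mathbb{R}$: if $|te^{i\theta}-\overline{\eta}|\ge 2(t^2-|\eta|^2)$, let $t_\theta$ be the unique solution $x$ of $|xe^{i\theta}-\overline{\eta}|=2(x^2-|\eta|^2)$, $x>|\eta|$; otherwise let $t_\theta=t$. Set $$\zeta_\theta=\frac{t_\theta e^{i\theta}-\overline{\eta}}{2(t_\theta^2-|\eta|^2)}\in\overline{\mathbb{D}}.$$ A ''parametric representation'' of $\partial V(r,s,\lambda)$ means that $\theta\mapsto\gamma(\theta)$ is a continuous bijection from $(-\pi,\pi]$ onto $\partial V(r,s,\lambda)$. *)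

(* Defs.v *)
(* Mathematical Components with MathComp-Analysis; the complex numbers are R[i]
   from real_closed, for an arbitrary R : realType. *)
From HB Require Import structures.
From mathcomp Require Import all_boot all_order all_algebra.
From mathcomp Require Import complex.
From mathcomp Require Import all_classical all_reals all_analysis.

Set Implicit Arguments.
Unset Strict Implicit.
Unset Printing Implicit Defensive.

Import Order.TTheory GRing.Theory Num.Theory numFieldNormedType.Exports.

Local Open Scope classical_set_scope.
Local Open Scope ring_scope.

(* MathComp-Analysis attaches the norm topology, differentiation, etc. to every
   numFieldType, but not to the concrete type R[i]; packaging R[i] as an explicit
   numFieldType gives access to all of it. *)
Definition Cplx (R : realType) : numFieldType := R[i].
Arguments Cplx : simpl never.

Definition ofR (R : realType) (x : R) : Cplx R := Complex x 0.
Notation "x %:C" := (ofR x) : ring_scope.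

Definition cconj (R : realType) (z : Cplx R) : Cplx R := conjc z.

(* The modulus as a real number, whereas `|z| : Cplx R is the same number seen
   in the complex field. *)
Definition cabs (R : realType) (z : Cplx R) : R := @ComplexField.Normc.normc R z.

Section PlaneTopology.
Variable R : realType.
Local Notation C := (Cplx R).
Implicit Types A J V : set C.

Definition boundary A : set C := closure A `\` interior A.

Definition closed_domain A :=
  exists D : set C, [/\ D !=set0, open D, connected D & A = closure D].

Definition jordan_curve J :=
  exists g : R -> C,
    [/\ {within `[0, 1], continuous g}, g 0 = g 1,
        {in `[0, 1[ &, injective g} & J = g @` `[0, 1]].

(* The points of the bounded components of the complement of J: for a Jordan
   curve there is exactly one such component. *)
Definition inside J : set C :=
  [set p | ~ J p /\ bounded_set (connected_component (~` J) p)].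

Definition enclosed_by V J := V = J `|` inside J.

Definition parametric_representation (g : R -> C) J :=
  {within `]- pi, pi], continuous g} /\ set_bij `]- pi, pi] J g.

End PlaneTopology.

Section ThirdDerivative.
Variable R : realType.
Local Notation C := (Cplx R).
Implicit Types (r s t x theta : R) (a z lambda eta zeta : C) (f : C -> C).

Definition disk : set C := [set z | `|z| < 1].

(* Each point of D is the centre of a power series that converges to f on some
   neighbourhood. *)
Definition analytic_on (D : set C) f :=
  forall z, D z -> exists a_ : nat -> C,
    \forall h \near (0 : C), series (fun n => a_ n * h ^+ n) @ \oo --> f (z + h).

(* Functions on the disk are represented by total functions on C, whose values
   outside the disk are irrelevant. *)
Definition H0 : set (C -> C) :=
  [set f | [/\ analytic_on disk f, f @` disk `<=` disk & f 0 = 0]].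

Definition H0_at r s lambda : set (C -> C) :=
  [set f | [/\ H0 f, f r%:C = s%:C &
     (f^`())%classic r%:C
       = (s / r)%:C + ((r ^+ 2 - s ^+ 2) / (r * (1 - r ^+ 2)))%:C * lambda]].

Definition V r s lambda : set C :=
  [set (f^`(3))%classic r%:C | f in H0_at r s lambda].

Definition T a z : C := (z + a) / (1 + cconj a * z).

Definition expi theta : C := Complex (cos theta) (sin theta).

(* The principal argument; junk value at 0. *)
Definition arg z : R :=
  [get a : R | - pi < a <= pi /\ z = (cabs z)%:C * expi a].

Definition constA r s : C :=
  (6 * (r ^+ 2 - s ^+ 2) / (r ^+ 3 * (1 - r ^+ 2) ^+ 3))%:C.

Definition constB r s lambda : C :=
  (s ^+ 2)%:C * lambda ^+ 3 - (s * (1 + r ^+ 2))%:C * lambda ^+ 2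
    + (r ^+ 2)%:C * lambda.

Definition denom r s lambda : C := (1 + r ^+ 2)%:C - (2 * s)%:C * lambda.

Definition constC r s lambda : C :=
  (r * (1 - cabs lambda ^+ 2))%:C * denom r s lambda.

Definition const_eta r s lambda : C := r%:C * cconj lambda / denom r s lambda.

Definition const_t r s lambda : R := r / cabs (denom r s lambda).

Definition c eta zeta : C := zeta * (1 - eta * zeta).

Definition rho t zeta : R := t * (1 - cabs zeta ^+ 2).

Definition t_ eta t theta : R :=
  if 2 * (t ^+ 2 - cabs eta ^+ 2) <= cabs (t%:C * expi theta - cconj eta) then
    [get x : R | cabs eta < x /\
       cabs (x%:C * expi theta - cconj eta) = 2 * (x ^+ 2 - cabs eta ^+ 2)]
  else t.

Definition zeta_ eta t theta : C :=
  let x := t_ eta t theta in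
  (x%:C * expi theta - cconj eta) / (2 * (x ^+ 2 - cabs eta ^+ 2))%:C.

End ThirdDerivative.

(* Main.v *)
Require Import Defs.
From HB Require Import structures.
From mathcomp Require Import all_boot all_order all_algebra.
From mathcomp Require Import complex.
From mathcomp Require Import all_classical all_reals all_analysis.
From mathcomp Require Import ring lra.

(** The Schur algorithm turns the interpolation problem into a problem with a
    free parameter.  If [f] fixes 0 then [f z = z * g1 z] with [g1] bounded by
    1 on the disk (Schwarz).  A function [g] of that kind, a Schur function,
    with [cabs (g p) < 1] can be written [g = T (g p) (T (- p) * h)] with [h]
    again a Schur function, and every such [h] occurs ([schur_step],
    [schur_T]).  Applied at [p = r] to [g1] with value [s / r], and then to the
    next function, whose value [lambda] is what [f^`()] prescribes, this gives
    [f = schur3 h] for an arbitrary Schur function [h].  Expanding to third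
    order at [r], [f'''(r)] is quadratic in [h r] and affine in [h'(r)]
    ([derive3_schur3]); by one more Schur step, [h'(r)] ranges over the disk of
    radius [(1 - |h r|^2) / (1 - r^2)].  With [zeta = h r] this gives

      V = { A (B + C (c zeta + rho zeta * w)) : |zeta| <= 1, |w| <= 1 }

    ([V_values]), a union of disks.  Moreover equality in [|w| <= 1], or in
    [|zeta| <= 1], makes the last Schur function constant, by the maximum
    principle, so that [f] is determined: this is the second half of the
    theorem ([extremal_interior], [extremal_boundary]).

    The rest is plane geometry.  Since [|eta| < t], the radius of the disks is
    more concave than their centres are curved, and [V] is convex
    ([V_real_convex]).  In the direction [C e^(i theta)] the support
    function of [V] is governed by the maximum over the closed disk of

      phi zeta = Re (e^(- i theta) c zeta) + t (1 - |zeta|^2),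

    a strictly concave quadratic function of [zeta].  Its maximum is the free
    critical point when that lies in the disk; otherwise it lies on the circle,
    where [t] may be replaced by a larger Lagrange parameter [t_theta] for which
    the free critical point falls on the circle.  In both cases it is
    [zeta_theta], and the gap [phi zeta_theta - phi zeta] is at least
    [(t - |eta|) |zeta - zeta_theta|^2] ([zeta_max]).  This one inequality gives
    uniqueness of the maximizer, hence that [gamma theta] is an exposed point,
    and Lipschitz dependence of [zeta_theta] on [e^(i theta)], hence continuity
    of [gamma].  Finally, a compact convex set with interior points whose
    exposed points in all directions form a continuous curve, injective on the
    circle of directions, has that curve as its boundary, and the boundary is
    a Jordan curve that encloses the set ([boundary_parametrized],
    [boundary_jordan], [convex_enclosed]).  The formulas with and without the
    term in [rho] describe the same point when [|zeta_theta| = 1], since [rho]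
    then vanishes; this covers the three cases at once.

    The complex analysis rests on germs of power series. A germ is described
    by geometric bounds on all the remainders of its Taylor polynomials
    ([taylor_bound]). These bounds pass to sums, products, reciprocals,
    quotients by the variable and derivatives by estimates on finite sums; the
    local maximum principle reads off the first nonconstant term of the
    series. *)

Set Implicit Arguments.
Unset Strict Implicit.
Unset Printing Implicit Defensive.

Import Order.TTheory GRing.Theory Num.Theory numFieldNormedType.Exports.

Local Open Scope classical_set_scope.
Local Open Scope ring_scope.

(** * The complex plane with a real-valued modulus *)

Section Modulus.
Variable R : realType.
Local Notation C := (Cplx R).
Implicit Types (x y : R) (z w : C).

Definition re z : R := complex.Re z.
Definition im z : R := complex.Im z.

Lemma eqC z w : re z = re w -> im z = im w -> z = w.
Proof. by case: z => a b; case: w => c d; rewrite /re /im /= => -> ->. Qed.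

Lemma cabsE z : `|z| = (cabs z)%:C.
Proof. by []. Qed.

Lemma cabs_sqrt z : cabs z = Num.sqrt (re z ^+ 2 + im z ^+ 2).
Proof. by case: z. Qed.

Lemma reD z w : re (z + w) = re z + re w. Proof. by case: z; case: w. Qed.
Lemma imD z w : im (z + w) = im z + im w. Proof. by case: z; case: w. Qed.
Lemma reN z : re (- z) = - re z. Proof. by case: z. Qed.
Lemma imN z : im (- z) = - im z. Proof. by case: z. Qed.
Lemma reM z w : re (z * w) = re z * re w - im z * im w.
Proof. by case: z; case: w. Qed.
Lemma imM z w : im (z * w) = re z * im w + im z * re w.
Proof. by case: z => a b; case: w. Qed.
Lemma re_ofR x : re x%:C = x. Proof. by []. Qed.
Lemma im_ofR x : im x%:C = 0. Proof. by []. Qed.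
Lemma re_conj z : re (cconj z) = re z. Proof. by case: z. Qed.
Lemma im_conj z : im (cconj z) = - im z. Proof. by case: z. Qed.
Definition reimE := (reD, imD, reN, imN, reM, imM, re_ofR, im_ofR, re_conj, im_conj).

Lemma ofRD x y : (x + y)%:C = x%:C + y%:C.
Proof. by apply: eqC; rewrite !reimE ?addr0. Qed.
Lemma ofRN x : (- x)%:C = - x%:C.
Proof. by apply: eqC; rewrite !reimE ?oppr0. Qed.
Lemma ofRB x y : (x - y)%:C = x%:C - y%:C.
Proof. by rewrite ofRD ofRN. Qed.
Lemma ofRM x y : (x * y)%:C = x%:C * y%:C.
Proof. by apply: eqC; rewrite !reimE ?mul0r ?mulr0 ?subr0 ?addr0. Qed.
Lemma ofR0 : 0%:C = 0 :> C. Proof. by []. Qed.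
Lemma ofR1 : 1%:C = 1 :> C. Proof. by []. Qed.
Lemma ofRX x n : (x ^+ n)%:C = x%:C ^+ n.
Proof. by elim: n => [|n IH]; rewrite ?expr0 // !exprS ofRM IH. Qed.
Lemma ofRn n : (n%:R)%:C = n%:R :> C.
Proof. by elim: n => [|n IH] //; rewrite -!natr1 ofRD IH. Qed.
Lemma ofR_eq0 x : (x%:C == 0) = (x == 0).
Proof. by rewrite /ofR; apply/eqP/eqP => [[]|->]. Qed.
Lemma ofRV x : (x^-1)%:C = (x%:C)^-1.
Proof.
have [->|x0] := eqVneq x 0; first by rewrite !(invr0, ofR0).
have x0' : x%:C != 0 by rewrite ofR_eq0.
by apply: (mulfI x0'); rewrite -ofRM !divff.
Qed.
Definition ofRE := (ofRD, ofRN, ofRM, ofRX, ofRV, ofRn, ofR0, ofR1).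

Lemma le_ofR x y : (x%:C <= y%:C) = (x <= y). Proof. exact: lecR. Qed.
Lemma lt_ofR x y : (x%:C < y%:C) = (x < y). Proof. exact: ltcR. Qed.
Lemma lt_ofR0 z : 0 < z -> exists2 e : R, 0 < e & z = e%:C.
Proof.
case: z => a b; rewrite ltcE /= => /andP[/eqP b0 a0].
by exists a => //; rewrite /ofR b0.
Qed.
Lemma ge_ofR0 z : 0 <= z -> exists2 e : R, 0 <= e & z = e%:C.
Proof.
case: z => a b; rewrite lecE /= => /andP[/eqP b0 a0].
by exists a => //; rewrite /ofR b0.
Qed.

Lemma cabs_ge0 z : 0 <= cabs z. Proof. by rewrite cabs_sqrt sqrtr_ge0. Qed.
Lemma cabsM z w : cabs (z * w) = cabs z * cabs w.
Proof. exact: ComplexField.Normc.normcM. Qed.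
Lemma cabsV z : cabs z^-1 = (cabs z)^-1.
Proof. exact: ComplexField.Normc.normcV. Qed.
Lemma cabs0 : cabs (0 : C) = 0. Proof. exact: ComplexField.Normc.normc0. Qed.
Lemma cabs1 : cabs (1 : C) = 1. Proof. exact: ComplexField.Normc.normc1. Qed.
Lemma cabs_eq0 z : (cabs z == 0) = (z == 0).
Proof.
apply/eqP/eqP => [/ComplexField.Normc.eq0_normc //|->]; exact: cabs0.
Qed.
Lemma cabs_gt0 z : (0 < cabs z) = (z != 0).
Proof. by rewrite lt_def cabs_ge0 andbT cabs_eq0. Qed.
Lemma cabsD z w : cabs (z + w) <= cabs z + cabs w.
Proof. exact: le_normcD. Qed.
Lemma cabsN z : cabs (- z) = cabs z. Proof. exact: normcN. Qed.
Lemma cabsB z w : cabs (z - w) = cabs (w - z).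
Proof. by rewrite -cabsN opprB. Qed.
Lemma cabsX z n : cabs (z ^+ n) = cabs z ^+ n.
Proof. by elim: n => [|n IH]; rewrite ?expr0 ?cabs1 // !exprS cabsM IH. Qed.
Lemma cabs_ofR x : cabs x%:C = `|x|.
Proof. by rewrite cabs_sqrt !reimE expr0n addr0 sqrtr_sqr. Qed.
Lemma cabs_conj z : cabs (cconj z) = cabs z.
Proof. by rewrite !cabs_sqrt !reimE sqrrN. Qed.
Lemma cabs_sqr z : cabs z ^+ 2 = re z ^+ 2 + im z ^+ 2.
Proof. by rewrite cabs_sqrt sqr_sqrtr // addr_ge0 // sqr_ge0. Qed.
Lemma mul_conj z : z * cconj z = (cabs z ^+ 2)%:C.
Proof. by rewrite cabs_sqr; apply: eqC; rewrite !reimE; ring. Qed.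
Lemma cabs_subl z w : cabs z - cabs w <= cabs (z - w).
Proof. by rewrite lerBlDr (le_trans _ (cabsD _ _)) // subrK. Qed.
Lemma cabs_subr z w : cabs z - cabs w <= cabs (z + w).
Proof. by rewrite -[w in z + w]opprK -(cabsN w) cabs_subl. Qed.
Lemma cabs_sum (I : Type) (s : seq I) (P : pred I) (F : I -> C) :
  cabs (\sum_(i <- s | P i) F i) <= \sum_(i <- s | P i) cabs (F i).
Proof.
elim/big_ind2: _ => [|x1 x2 y1 y2 h1 h2|//]; first by rewrite cabs0.
by rewrite (le_trans (cabsD _ _)) // lerD.
Qed.
Lemma re_le_cabs z : re z <= cabs z.
Proof.
rewrite cabs_sqrt; apply: (le_trans (ler_norm _)).
by rewrite -sqrtr_sqr ler_sqrt ?addr_ge0 ?sqr_ge0 // lerDl sqr_ge0.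
Qed.
Lemma im_le_cabs z : im z <= cabs z.
Proof.
rewrite cabs_sqrt; apply: (le_trans (ler_norm _)).
by rewrite -sqrtr_sqr ler_sqrt ?addr_ge0 ?sqr_ge0 // lerDr sqr_ge0.
Qed.
Lemma abs_re_le z : `|re z| <= cabs z.
Proof.
rewrite ler_norml re_le_cabs andbT lerNl -reN -cabsN; exact: re_le_cabs.
Qed.
Lemma abs_im_le z : `|im z| <= cabs z.
Proof.
rewrite ler_norml im_le_cabs andbT lerNl -imN -cabsN; exact: im_le_cabs.
Qed.
Lemma cabs_le_reim z : cabs z <= `|re z| + `|im z|.
Proof.
rewrite -(@ler_pXn2r _ 2) ?nnegrE ?cabs_ge0 ?addr_ge0 ?normr_ge0 // cabs_sqr.
rewrite sqrrD !real_normK ?num_real //.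
have := mulr_ge0 (normr_ge0 (re z)) (normr_ge0 (im z)); lra.
Qed.
Lemma re_eq_cabs z : re z = cabs z -> z = (cabs z)%:C.
Proof.
move=> h; apply: eqC; rewrite !reimE //.
have := cabs_sqr z; rewrite -h => /eqP; rewrite -subr_eq0 opprD addrA subrr sub0r.
by rewrite oppr_eq0 sqrf_eq0 => /eqP.
Qed.

Lemma cconjM z w : cconj (z * w) = cconj z * cconj w.
Proof. exact: rmorphM. Qed.
Lemma cconjD z w : cconj (z + w) = cconj z + cconj w.
Proof. exact: rmorphD. Qed.
Lemma cconjN z : cconj (- z) = - cconj z.
Proof. exact: rmorphN. Qed.
Lemma cconjK z : cconj (cconj z) = z. Proof. exact: conjcK. Qed.
Lemma cconjV z : cconj z^-1 = (cconj z)^-1.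
Proof. exact: conjc_inv. Qed.
Lemma cconj_ofR x : cconj x%:C = x%:C. Proof. exact: conjc_real. Qed.
Lemma cconj_nat n : cconj (n%:R : C) = n%:R.
Proof. by rewrite -ofRn cconj_ofR. Qed.
Lemma cconj1 : cconj (1 : C) = 1. Proof. exact: conjc1. Qed.
Lemma diskE z : disk z = (cabs z < 1).
Proof. by rewrite /disk /= cabsE -ofR1 lt_ofR. Qed.

Lemma nbhs_cabs z (A : set C) :
  nbhs z A <-> exists2 e : R, 0 < e & forall w, cabs (w - z) < e -> A w.
Proof.
split.
  move=> /nbhs_ballP[e /= e0 He]; have [e' e'0 ee'] := lt_ofR0 e0.
  exists e' => // w wz; apply: He; rewrite ee' -ball_normE /= cabsE lt_ofR.
  by rewrite cabsB.
move=> [e e0 He]; apply/nbhs_ballP; exists e%:C; first by rewrite /= -ofR0 lt_ofR.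
by move=> w; rewrite -ball_normE /= cabsE lt_ofR cabsB => /He.
Qed.

Lemma cvgC (T : Type) (F : set_system T) (FF : Filter F) (f : T -> C) z :
  (forall e : R, 0 < e -> \forall u \near F, cabs (f u - z) < e) -> f @ F --> z.
Proof.
move=> H A /nbhs_cabs[e e0 He].
by near=> u; apply: He; near: u; exact: H.
Unshelve. all: by end_near. Qed.

Lemma cvgC_near (T : Type) (F : set_system T) (FF : Filter F) (f : T -> C) z :
  f @ F --> z -> forall e : R, 0 < e -> \forall u \near F, cabs (f u - z) < e.
Proof.
by move=> H e e0; apply: (H [set w | cabs (w - z) < e]); apply/nbhs_cabs; exists e.
Qed.

Lemma cabs_continuous : continuous (@cabs R).
Proof.
move=> z A /nbhs_ballP[e /= e0 He]; apply/nbhs_cabs; exists e => // w wz.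
apply: He; rewrite /ball /= distrC; apply: le_lt_trans wz.
have h1 := cabs_subl w z; have h2 := cabs_subl z w; rewrite cabsB in h2.
by rewrite ler_norml; apply/andP; split; lra.
Qed.

Lemma re_continuous : continuous re.
Proof.
move=> z A /nbhs_ballP[e /= e0 He]; apply/nbhs_cabs; exists e => // w wz.
apply: He; rewrite /ball /= distrC; apply: le_lt_trans wz.
by rewrite -reN -reD abs_re_le.
Qed.

Lemma continuousC (T : topologicalType) (f : T -> C) :
  continuous (re \o f) -> continuous (im \o f) -> continuous f.
Proof.
move=> hr hi u; apply: cvgC => e e0.
have e2 : 0 < e / 2 by lra.
have h1 : \forall v \near u, `|re (f u) - re (f v)| < e / 2.
  by move: (hr u) => /cvgrPdist_lt; apply.
have h2 : \forall v \near u, `|im (f u) - im (f v)| < e / 2.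
  by move: (hi u) => /cvgrPdist_lt; apply.
near=> v; rewrite cabsB.
apply: le_lt_trans (cabs_le_reim _) _.
rewrite !(reD, imD, reN, imN) [e]splitr ltrD //; near: v => //.
Unshelve. all: by end_near. Qed.

Lemma ofR_continuous : continuous (@ofR R).
Proof. apply: continuousC => [x|]; [exact: cvg_id|exact: cst_continuous]. Qed.

Lemma cconj_continuous : continuous (@cconj R).
Proof.
move=> z; apply: (@cvgC _ (nbhs z) _ _ (cconj z)) => e e0.
apply/nbhs_cabs; exists e => // w; by rewrite -cconjN -cconjD cabs_conj.
Qed.

Lemma re_expi x : re (expi x) = cos x. Proof. by []. Qed.
Lemma im_expi x : im (expi x) = sin x. Proof. by []. Qed.
Lemma cabs_expi x : cabs (expi x) = 1.
Proof. by rewrite cabs_sqrt re_expi im_expi cos2Dsin2 sqrtr1. Qed.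
Lemma expiD x y : expi (x + y) = expi x * expi y.
Proof.
by apply: eqC; rewrite !reimE !(re_expi, im_expi) (cosD, sinD); ring.
Qed.
Lemma expi_conj x : expi x * cconj (expi x) = 1.
Proof. by rewrite mul_conj cabs_expi expr1n. Qed.
Lemma expi_continuous : continuous (@expi R).
Proof. apply: continuousC; [exact: continuous_cos|exact: continuous_sin]. Qed.
Lemma expi_pi : expi (- pi) = expi pi :> C.
Proof. by apply: eqC; rewrite !(re_expi, im_expi) ?cosN // sinN sinpi oppr0. Qed.

(** The angle is the arc cosine of the real part, with the sign of the
    imaginary part.  The point -1 belongs to the first case, which is why the
    interval is closed at pi. *)
Lemma expi_surj z : cabs z = 1 -> exists2 a : R, - pi < a <= pi & z = expi a.
Proof.
move=> z1; have := cabs_sqr z; rewrite z1 expr1n => h.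
have rez : -1 <= re z <= 1 by rewrite -ler_norml -z1 abs_re_le.
have [z0|z0] := leP 0 (im z).
  exists (acos (re z)); first by rewrite acos_lepi // andbT (lt_le_trans _ (acos_ge0 _)) // oppr_lt0 pi_gt0.
  apply: eqC; rewrite ?re_expi ?im_expi ?acosK ?sin_acos //.
  by rewrite h [X in X - _]addrC addrK sqrtr_sqr ger0_norm.
have ren1 : -1 < re z.
  have : 0 < im z ^+ 2 by rewrite exprn_even_gt0 //= lt_eqF.
  case/andP: rez => r1 r2 i0; rewrite lt_neqAle r1 andbT; apply/eqP => e.
  by move: h; rewrite -e sqrrN expr1n; lra.
exists (- acos (re z)).
  by rewrite ltrN2 acos_ltpi // ?ren1; [rewrite (le_trans _ (pi_ge0 _)) // oppr_le0 acos_ge0 //|case/andP: rez].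
apply: eqC; rewrite ?re_expi ?im_expi ?cosN ?sinN ?acosK ?sin_acos //.
by rewrite h [X in X - _]addrC addrK sqrtr_sqr ltr0_norm // opprK.
Qed.

(** Equality of the two points means that the angles differ by a number in [0,
    2 pi[ whose cosine is 1; the cosine is injective on [0, pi], and a
    difference beyond pi is reflected to that interval. *)
Lemma expi_inj x y : - pi < x <= pi -> - pi < y <= pi -> expi x = expi y -> x = y.
Proof.
wlog xy : x y / x <= y.
  by move=> H hx hy e; case: (leP x y) => [/H|/ltW/H] h; [|symmetry]; apply: h.
move=> /andP[x1 x2] /andP[y1 y2] e.
have c1 : cos (y - x) = 1.
  have := congr1 re e; have := congr1 im e; rewrite !(re_expi, im_expi) => es ec.
  by rewrite cosB ec es; have := cos2Dsin2 y; lra.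
have [yx|yx] := leP (y - x) pi.
  suff : y - x = 0 by lra.
  apply: (@cos_inj R); rewrite ?cos0 // ?in_itv /= ?yx ?lexx ?pi_ge0 //; lra.
have : 2 * pi - (y - x) = 0.
  apply: (@cos_inj R); rewrite ?in_itv /= ?lexx ?pi_ge0 //; first by apply/andP; split; lra.
  by rewrite cos0 mulr_natl cosB cos2pi sin2pi c1; lra.
lra.
Qed.

Lemma argP z : z != 0 -> z = (cabs z)%:C * expi (arg z).
Proof.
move=> z0; rewrite /arg; have z0' : cabs z != 0 by rewrite cabs_eq0.
have [|a ha e] := @expi_surj (z / (cabs z)%:C).
  by rewrite cabsM cabsV cabs_ofR ger0_norm ?cabs_ge0 // divff.
have [_ //] : (fun a : R => - pi < a <= pi /\ z = (cabs z)%:C * expi a) (get (fun a : R => - pi < a <= pi /\ z = (cabs z)%:C * expi a)).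
apply: (@getPex _ (fun a : R => - pi < a <= pi /\ z = (cabs z)%:C * expi a)).
by exists a; split => //; rewrite -e mulrCA divff ?mulr1 // ofR_eq0.
Qed.

End Modulus.

(** * Power-series germs with geometric remainders *)

Section Germs.
Variable R : realType.
Local Notation C := (Cplx R).
Implicit Types (f g : C -> C) (z w h : C) (a b : nat -> C) (M K q : R).

Definition psum a N h : C := \sum_(n < N) a n * h ^+ n.

(** Uniform geometric control of the remainder at every order.  It implies
    that the power series with coefficients a converges to f near z, but
    unlike convergence it can be handled by estimates on finite sums: products
    and quotients need no rearrangement of double series, and no limit has to
    be shown to exist. *)
Definition taylor_bound M K f z a :=
  forall N h, K * cabs h <= 1 ->
    cabs (f (z + h) - psum a N h) <= M * (K * cabs h) ^+ N.

Definition taylor f z a :=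
  exists M K, [/\ 0 <= M, 0 < K & taylor_bound M K f z a].

Lemma psumS a N h : psum a N.+1 h = psum a N h + a N * h ^+ N.
Proof. exact: big_ord_recr. Qed.

Lemma psum0 a h : psum a 0 h = 0. Proof. exact: big_ord0. Qed.

Lemma taylor_bound_le M K M' K' f z a : 0 <= M -> M <= M' -> 0 < K -> K <= K' ->
  taylor_bound M K f z a -> taylor_bound M' K' f z a.
Proof.
move=> M0 MM K0 KK H N h Kh; have hh := cabs_ge0 h.
have Kh' : K * cabs h <= K' * cabs h by rewrite ler_wpM2r.
apply: le_trans (H N h (le_trans Kh' Kh)) _.
apply: ler_pM => //; first by rewrite exprn_ge0 // mulr_ge0 // ltW.
by apply: lerXn2r => //; rewrite nnegrE mulr_ge0 // ltW // (lt_le_trans K0).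
Qed.

Lemma taylor_common f g z w a b : taylor f z a -> taylor g w b ->
  exists M K, [/\ 0 <= M, 0 < K, taylor_bound M K f z a & taylor_bound M K g w b].
Proof.
move=> [M [K [M0 K0 H]]] [M' [K' [M0' K0' H']]].
exists (M + M'), (K + K'); split; [lra|lra| |].
- by apply: (taylor_bound_le _ _ _ _ H); lra.
- by apply: (taylor_bound_le _ _ _ _ H'); lra.
Qed.

(** Cauchy estimate: the term of order n is the difference of two consecutive
    remainders, evaluated at distance 1 / K. *)
Lemma taylor_coef_le M K f z a : 0 < K -> taylor_bound M K f z a ->
  forall n, cabs (a n) <= 2 * M * K ^+ n.
Proof.
move=> K0 H n; have Kn : 0 < K ^+ n by rewrite exprn_gt0.
pose h : C := (K^-1)%:C.
have ch : cabs h = K^-1 by rewrite cabs_ofR ger0_norm // invr_ge0 ltW.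
have K1 : K * cabs h = 1 by rewrite ch divff // gt_eqF.
have h1 := H n h; have h2 := H n.+1 h.
rewrite K1 !expr1n mulr1 lexx in h1 h2.
rewrite -ler_pdivrMr // -exprVn -ch -cabsX -cabsM.
have -> : a n * h ^+ n = (f (z + h) - psum a n h) - (f (z + h) - psum a n.+1 h).
  by rewrite psumS; ring.
apply: le_trans (cabsD _ _) _; rewrite cabsN.
by have := h1 isT; have := h2 isT; lra.
Qed.

Lemma taylor_value f z a : taylor f z a -> f z = a 0%N.
Proof.
move=> [M [K [M0 K0 /(_ 1%N 0)]]].
rewrite cabs0 mulr0 ler01 expr1 mulr0 addr0 /psum big_ord1 expr0 mulr1 => /(_ isT).
by move=> h; apply/eqP; rewrite -subr_eq0 -cabs_eq0 eq_le h cabs_ge0.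
Qed.

Lemma taylor_near f g z a : (\forall w \near z, f w = g w) ->
  taylor f z a -> taylor g z a.
Proof.
move=> /nbhs_cabs[e e0 fg] [M [K [M0 K0 H]]].
exists M, (K + 2 / e); split => //; first by rewrite addr_gt0 // divr_gt0.
move=> N h Kh; rewrite -fg.
  apply: (taylor_bound_le _ _ _ _ H) => //.
  by rewrite lerDl divr_ge0 // ltW.
rewrite addrC addKr -(ltr_pM2l (_ : 0 < 2 / e)) ?divr_gt0 //.
rewrite divfK ?gt_eqF //; have := mulr_ge0 (ltW K0) (cabs_ge0 h); move: Kh; rewrite mulrDl; lra.
Qed.

Lemma taylor_cst (c : C) z : taylor (fun=> c) z (fun n => if n is 0%N then c else 0).
Proof.
exists (cabs c), 1; split; rewrite ?cabs_ge0 // => -[|N] h _.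
  by rewrite psum0 subr0 expr0 mulr1.
rewrite /psum big_ord_recl /= big1 ?expr0 ?mulr1 ?addr0 ?subrr ?cabs0.
  by rewrite mulr_ge0 ?cabs_ge0 // exprn_ge0 // mulr_ge0 // cabs_ge0.
by move=> i _; rewrite mul0r.
Qed.

Lemma taylor_id z : taylor id z (fun n => match n with 0%N => z | 1%N => 1 | _ => 0 end).
Proof.
have z0 := cabs_ge0 z.
exists (cabs z + 1), 1; split => [|//|]; first lra.
move=> [|[|N]] h; rewrite mul1r => h1; have h0 := cabs_ge0 h.
- by rewrite psum0 subr0 expr0 mulr1 (le_trans (cabsD _ _)) // lerD.
- rewrite psumS psum0 /= add0r expr0 mulr1 addrC addKr expr1; nra.
rewrite /psum big_ord_recl big_ord_recl /= big1 => [|i _]; last by rewrite mul0r.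
rewrite /bump /= expr0 expr1 mulr1 mul1r addr0 subrr cabs0.
by rewrite mulr_ge0 ?exprn_ge0 //; lra.
Qed.

Lemma taylorD f g z a b : taylor f z a -> taylor g z b ->
  taylor (fun w => f w + g w) z (fun n => a n + b n).
Proof.
move=> hf hg; have [M [K [M0 K0 H H']]] := taylor_common hf hg.
exists (M + M), K; split => //; first lra.
move=> N h Kh.
have -> : f (z + h) + g (z + h) - psum (fun n => a n + b n) N h =
   (f (z + h) - psum a N h) + (g (z + h) - psum b N h).
  rewrite /psum [X in _ - X](_ : _ = psum a N h + psum b N h) ?/psum; first ring.
  by rewrite -big_split /=; apply: eq_bigr => i _; rewrite mulrDl.
by rewrite (le_trans (cabsD _ _)) // mulrDl lerD // ?H ?H'.
Qed.

Definition cauchy_prod a b n : C := \sum_(i < n.+1) a i * b (n - i)%N.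

(** The truncated Cauchy product collects the terms of total degree less than
    N: for each term of the first series, the partial sum of the second one of
    the complementary order. *)
Lemma psum_cauchy_prod a b N h :
  psum (cauchy_prod a b) N h = \sum_(i < N) a i * h ^+ i * psum b (N - i) h.
Proof.
elim: N => [|N IH]; first by rewrite psum0 big_ord0.
rewrite psumS IH /cauchy_prod mulr_suml.
rewrite [in RHS](eq_bigr (fun i : 'I_N.+1 =>
   a i * h ^+ i * psum b (N - i) h + a i * b (N - i)%N * h ^+ N)).
  rewrite big_split /= [X in _ = X + _]big_ord_recr /= subnn psum0 mulr0 addr0.
  by [].
move=> i _; have iN : (i <= N)%N by rewrite -ltnS.
rewrite subSn // psumS mulrDr; congr (_ + _).
by rewrite mulrACA -exprD subnKC.
Qed.

(** Splits the remainder of a product into remainders of the factors, with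
    total order N in each term. *)
Lemma remainder_prod (x y : C) a b N h :
  x * y - psum (cauchy_prod a b) N h =
  (x - psum a N h) * y + \sum_(i < N) a i * h ^+ i * (y - psum b (N - i) h).
Proof.
rewrite psum_cauchy_prod.
under [in RHS]eq_bigr do rewrite mulrBr.
rewrite sumrB -mulr_suml -/(psum a N h); ring.
Qed.

(** By remainder_prod the error is a sum of N + 1 terms of the order of the
    N-th power of K |h|; doubling K absorbs the growth of N + 1. *)
Lemma taylorM f g z a b : taylor f z a -> taylor g z b ->
  taylor (fun w => f w * g w) z (cauchy_prod a b).
Proof.
move=> hf hg; have [M [K [M0 K0 H H']]] := taylor_common hf hg.
exists (2 * M * M), (2 * K); split; [nra|lra|].
move=> N h Kh; have h0 := cabs_ge0 h.
have Kh0 : 0 <= K * cabs h by rewrite mulr_ge0 // ltW.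
have Kh1 : K * cabs h <= 1 by lra.
set q := K * cabs h in Kh0 Kh1.
have qN := exprn_ge0 N Kh0.
rewrite remainder_prod; apply: le_trans (cabsD _ _) _.
have gM : cabs (g (z + h)) <= M.
  by have := H' 0%N h Kh1; rewrite psum0 subr0 expr0 mulr1.
have e1 : cabs ((f (z + h) - psum a N h) * g (z + h)) <= M * q ^+ N * M.
  by rewrite cabsM ler_pM ?cabs_ge0 // H.
have e2 : cabs (\sum_(i < N) a i * h ^+ i * (g (z + h) - psum b (N - i) h))
   <= N%:R * (2 * M * M * q ^+ N).
  apply: le_trans (cabs_sum _ _ _) _.
  rewrite mulr_natl -[X in _ *+ X]card_ord -sumr_const; apply: ler_sum => i _.
  rewrite !cabsM cabsX -[in q ^+ N](subnKC (ltnW (ltn_ord i))) exprD.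
  have -> : 2 * M * M * (q ^+ i * q ^+ (N - i)) =
     (2 * M * K ^+ i * cabs h ^+ i) * (M * q ^+ (N - i)) by rewrite /q !exprMn; ring.
  apply: ler_pM; rewrite ?cabs_ge0 ?mulr_ge0 ?exprn_ge0 ?cabs_ge0 //; last exact: H'.
  by rewrite ler_wpM2r ?exprn_ge0 // (taylor_coef_le K0 H).
rewrite -[2 * K * cabs h]mulrA -/q exprMn.
have n2 : N%:R + 1 <= 2 ^+ N :> R.
  by rewrite natr1 -natrX ler_nat ltn_expl.
have P0 : 0 <= M * M * q ^+ N by rewrite mulr_ge0 // mulr_ge0.
have N0 : 0 <= (N%:R : R) by [].
have -> : 2 * M * M * (2 ^+ N * q ^+ N) = 2 * 2 ^+ N * (M * M * q ^+ N) by ring.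
apply: le_trans (lerD e1 e2) _.
have -> : M * q ^+ N * M + N%:R * (2 * M * M * q ^+ N) =
  (1 + 2 * N%:R) * (M * M * q ^+ N) by ring.
by rewrite ler_wpM2r //; lra.
Qed.

Lemma geom_le q N m : 0 <= q <= 1 / 2 -> \sum_(i < m) q ^+ (N + i) <= 2 * q ^+ N.
Proof.
move=> /andP[q0 q2]; elim: m N => [|m IH] N.
  by rewrite big_ord0 mulr_ge0 // exprn_ge0.
rewrite big_ord_recl addn0.
under eq_bigr do rewrite /= /bump /= add1n addnS -addSn.
have := IH N.+1; rewrite exprS; have := exprn_ge0 N q0; nra.
Qed.

Lemma psum_diff a N m h :
  psum a (N + m) h - psum a N h = \sum_(i < m) a (N + i)%N * h ^+ (N + i).
Proof.
elim: m => [|m IH]; first by rewrite addn0 subrr big_ord0.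
by rewrite addnS psumS big_ord_recr /= -IH; ring.
Qed.

End Germs.

(** * Reciprocals, divided germs and convergent power series *)

Section GermDivision.
Variable R : realType.
Local Notation C := (Cplx R).
Implicit Types (f g : C -> C) (z w h : C) (a b : nat -> C) (M K q : R).

(** The recursion for the coefficients of 1 / f needs all the previous ones,
    so they are accumulated in a sequence. *)
Fixpoint recip_seq a n : seq C :=
  if n is m.+1 then
    let s := recip_seq a m in
    rcons s (((m == 0)%N%:R - \sum_(i < m) a i.+1 * s`_(m - i.+1)) / a 0%N)
  else [::].

Definition recip a n : C := (recip_seq a n.+1)`_n.

Lemma size_recip_seq a n : size (recip_seq a n) = n.
Proof. by elim: n => //= n IH; rewrite size_rcons IH. Qed.

Lemma recip_seqE a n i : (i < n)%N -> (recip_seq a n)`_i = recip a i.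
Proof.
elim: n => // n IH; rewrite ltnS leq_eqVlt => /orP[/eqP ->//|lt].
by rewrite [LHS]/= nth_rcons size_recip_seq lt IH.
Qed.

Lemma cauchy_prod_recip a n : a 0%N != 0 -> cauchy_prod a (recip a) n = (n == 0)%N%:R.
Proof.
move=> a0; rewrite /cauchy_prod big_ord_recl subn0 {1}/recip [recip_seq _ _]/= nth_rcons size_recip_seq ltnn eqxx.
rewrite mulrC divfK //.
rewrite [X in _ - X](eq_bigr (fun i : 'I_n => a (bump 0 i) * recip a (n - bump 0 i)%N)).
  by rewrite subrK.
move=> i _; rewrite recip_seqE // ltn_subrL /=; exact: leq_trans (ltn_ord i).
Qed.

Lemma psum_delta N h : psum (fun n => (n == 0)%N%:R) N.+1 h = 1.
Proof.
rewrite /psum big_ord_recl /= big1 => [|i _]; last by rewrite mul0r.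
by rewrite mulr1 addr0.
Qed.

(** From f * (1 / f) = 1, remainder_prod expresses the remainder of 1 / f at
    order N through its remainders at lower orders, weighted by the
    coefficients of f.  By strong induction it stays below a geometric
    sequence whose ratio L is so much larger than K that the weights sum to at
    most |a 0|. *)
Lemma taylorV f z a : taylor f z a -> f z != 0 ->
  taylor (fun w => (f w)^-1) z (recip a).
Proof.
move=> hf fz; have a0 : a 0%N != 0 by rewrite -(taylor_value hf).
have [M [K [M0 K0 H]]] := hf.
have ca0 : 0 < cabs (a 0%N) by rewrite cabs_gt0.
set m := cabs (a 0%N) in ca0.
(* The first summand gives K / L <= 1 / 2, the second one 4 M K / L <= m. *)
pose L := 2 * K + 4 * M * K / m.
have MKm : 0 <= 4 * M * K / m by rewrite divr_ge0 ?(ltW ca0) // mulr_ge0 ?(ltW K0) //; lra.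
have L0 : 0 < L by rewrite /L; lra.
have Lm : 4 * M * K <= L * m.
  have -> : L * m = 2 * K * m + 4 * M * K / m * m by rewrite /L; ring.
  by rewrite divfK ?gt_eqF // lerDr mulr_ge0 ?(ltW ca0) //; lra.
have gbound : forall h, L * cabs h <= 1 -> f (z + h) != 0 /\ cabs (f (z + h))^-1 <= 2 / m.
  move=> h Lh; have h0 := cabs_ge0 h.
  have Kh : K * cabs h <= 1.
    by apply: le_trans Lh; rewrite ler_wpM2r // /L; lra.
  have := H 1%N h Kh; rewrite psumS psum0 add0r expr0 mulr1 expr1.
  rewrite cabsB => h1; have := cabs_subl (a 0%N) (a 0%N - f (z + h)).
  rewrite subKr -/m => h2.
  have h3 : 4 * M * K * cabs h <= m.
    apply: le_trans (_ : L * m * cabs h <= _); first by rewrite ler_wpM2r.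
    by rewrite mulrAC ler_piMl // ltW.
  have h4 : m / 2 <= cabs (f (z + h)) by nra.
  have h5 : 0 < cabs (f (z + h)) by lra.
  split; first by rewrite -cabs_gt0.
  rewrite cabsV -[2]invrK -invfM lef_pV2 ?posrE //; last by rewrite mulr_gt0 // invr_gt0.
  lra.
have m2 : 0 <= 2 / m by rewrite divr_ge0 // ltW.
exists (2 / m), L; split => // N; have [k] := ubnP N; elim: k N => // k IH [|N] Nk h Lh.
  by rewrite psum0 subr0 expr0 mulr1; exact: (gbound h Lh).2.
have [fh gh] := gbound h Lh; have h0 := cabs_ge0 h.
have Kh : K * cabs h <= 1 by apply: le_trans Lh; rewrite ler_wpM2r // /L; lra.
set x := f (z + h) in fh gh *; set b := recip a.
have key : a 0%N * (x^-1 - psum b N.+1 h) =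
  - ((x - psum a N.+1 h) * x^-1) -
  \sum_(i < N) a i.+1 * h ^+ i.+1 * (x^-1 - psum b (N - i) h).
  have := remainder_prod x x^-1 a b N.+1 h.
  rewrite divff // (_ : psum (cauchy_prod a b) N.+1 h = 1); last first.
    rewrite -[RHS](psum_delta N h); apply: eq_bigr => i _.
    by rewrite cauchy_prod_recip.
  rewrite subrr big_ord_recl subn0 /= expr0 mulr1.
  under eq_bigr do rewrite /bump /= add1n subSS.
  move=> /esym/eqP; rewrite addr_eq0 => /eqP ->; ring.
rewrite -(ler_pM2l ca0) -cabsM key.
apply: le_trans (cabsD _ _) _; rewrite !cabsN.
have q0 : 0 <= L * cabs h by rewrite mulr_ge0 // ltW.
set q := L * cabs h in Lh q0 *.
pose e := K / L.
have e0 : 0 <= e by rewrite divr_ge0 // ltW.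
have e2 : e <= 1 / 2 by rewrite /e ler_pdivrMr // /L; lra.
have Kq : K * cabs h = e * q by rewrite /e /q mulrA divfK // gt_eqF.
have Me : 4 * M * e <= m by rewrite /e mulrA ler_pdivrMr // [m * _]mulrC.
have t1 : cabs ((x - psum a N.+1 h) * x^-1) <= (2 / m) * (M * e ^+ N.+1 * q ^+ N.+1).
  rewrite cabsM mulrC ler_pM ?cabs_ge0 //.
  by have := H N.+1 h Kh; rewrite Kq exprMn mulrA.
have t2 : cabs (\sum_(i < N) a i.+1 * h ^+ i.+1 * (x^-1 - psum b (N - i) h)) <=
  (2 / m) * (2 * M * (\sum_(i < N) e ^+ (1 + i)) * q ^+ N.+1).
  apply: le_trans (cabs_sum _ _ _) _.
  rewrite mulr_sumr mulr_suml mulr_sumr; apply: ler_sum => i _.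
  rewrite !cabsM cabsX add1n.
  have iN := ltn_ord i.
  have -> : 2 / m * (2 * M * e ^+ i.+1 * q ^+ N.+1) =
    (2 * M * K ^+ i.+1 * cabs h ^+ i.+1) * (2 / m * q ^+ (N - i)).
    have -> : N.+1 = (i.+1 + (N - i))%N by rewrite addSn subnKC // ltnW.
    rewrite exprD.
    have eq1 : K ^+ i.+1 * cabs h ^+ i.+1 = e ^+ i.+1 * q ^+ i.+1.
      by rewrite -!exprMn Kq.
    transitivity (2 * M * (K ^+ i.+1 * cabs h ^+ i.+1) * (2 / m * q ^+ (N - i))).
      by rewrite eq1; ring.
    by ring.
  apply: ler_pM; rewrite ?cabs_ge0 ?mulr_ge0 ?exprn_ge0 ?cabs_ge0 //.
    by rewrite ler_wpM2r ?exprn_ge0 // (taylor_coef_le K0 H).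
  by apply: IH => //; exact: leq_ltn_trans (leq_subr i N) Nk.
apply: le_trans (lerD t1 t2) _.
rewrite -mulrDr mulrCA ler_wpM2l // -mulrDl ler_wpM2r ?exprn_ge0 //.
apply: le_trans Me.
have g := @geom_le _ e 1 N.+1 _; rewrite e0 e2 expr1 in g; have {}g := g isT.
rewrite big_ord_recr /= add1n in g.
have := exprn_ge0 N.+1 e0.
set u := e ^+ N.+1 in g *; set v := \sum_(_ < _) _ in g *; nra.
Qed.

(** The remainder of the quotient at order N is the remainder of f at order N
    + 1, divided by h. *)
Lemma taylor_shift f g z a : taylor f z a ->
  (forall h, h != 0 -> f (z + h) = f z + h * g (z + h)) -> g z = a 1%N ->
  taylor g z (fun n => a n.+1).
Proof.
move=> hf fg gz; have [M [K [M0 K0 H]]] := hf.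
have fz := taylor_value hf.
exists (2 * M * K), K; split => //; first by rewrite !mulr_ge0 // ltW.
move=> N h Kh; have [->|h0] := eqVneq h 0.
  rewrite addr0 gz cabs0 mulr0 /psum; case: N => [|N].
    by rewrite big_ord0 subr0 expr0 mulr1 -[K in _ * _ * K]expr1 (taylor_coef_le K0 H).
  rewrite big_ord_recl big1 => [|i _]; last by rewrite /= expr0n mulr0.
  by rewrite expr0 mulr1 addr0 subrr cabs0 expr0n mulr0.
have ch : 0 < cabs h by rewrite cabs_gt0.
rewrite -(ler_pM2l ch) -cabsM.
have -> : h * (g (z + h) - psum (fun n => a n.+1) N h) = f (z + h) - psum a N.+1 h.
  rewrite fg // fz [in RHS]/psum big_ord_recl expr0 mulr1 mulrBr mulr_sumr.
  under [in RHS]eq_bigr do rewrite /= exprS mulrCA.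
  ring.
apply: le_trans (H N.+1 h Kh) _; rewrite exprS.
have : 0 <= M * (K * cabs h) * (K * cabs h) ^+ N.
  by rewrite !mulr_ge0 ?exprn_ge0 ?mulr_ge0 ?cabs_ge0 // ltW.
nra.
Qed.

(** The first coefficients that differ would differ by a remainder of the next
    order divided by a power of h, which tends to 0. *)
Lemma taylor_unique f z a b : taylor f z a -> taylor f z b -> forall n, a n = b n.
Proof.
move=> ha hb; have [M [K [M0 K0 H H']]] := taylor_common ha hb.
move=> n; have [k] := ubnP n; elim: k n => // k IH n nk.
have ab : forall h, psum a n h = psum b n h.
  by move=> h; apply: eq_bigr => i _; rewrite IH // (leq_trans (ltn_ord i)).
apply/eqP; rewrite -subr_eq0 -cabs_eq0 eq_le cabs_ge0 andbT.
apply/ler_addgt0Pr => e e0; rewrite add0r.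
pose r := Num.min (1 / K) (e / (2 * M * K ^+ n.+1 + 1)).
have MK : 0 <= 2 * M * K ^+ n.+1 by rewrite !mulr_ge0 // exprn_ge0 // ltW.
have r0 : 0 < r.
  by rewrite lt_min !divr_gt0 //; lra.
pose h : C := r%:C; have ch : cabs h = r by rewrite cabs_ofR gtr0_norm.
have Kh : K * cabs h <= 1.
  by rewrite ch mulrC -ler_pdivlMr // /r ge_min lexx.
have h1 := H n.+1 h Kh; have h2 := H' n.+1 h Kh.
have rn : 0 < r ^+ n by rewrite exprn_gt0.
rewrite -(ler_pM2r rn) -{1}ch -cabsX -cabsM.
have -> : (a n - b n) * h ^+ n =
  (f (z + h) - psum b n.+1 h) - (f (z + h) - psum a n.+1 h).
  by rewrite !psumS ab; ring.
apply: le_trans (cabsD _ _) _; rewrite cabsN; apply: le_trans (lerD h2 h1) _.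
rewrite ch exprMn [r ^+ n.+1]exprS.
have -> : M * (K ^+ n.+1 * (r * r ^+ n)) + M * (K ^+ n.+1 * (r * r ^+ n)) =
   (2 * M * K ^+ n.+1) * r * r ^+ n by ring.
rewrite ler_wpM2r ?(ltW rn) //.
have : r * (2 * M * K ^+ n.+1 + 1) <= e.
  by rewrite -ler_pdivlMr ?ge_min ?lexx ?orbT //; lra.
lra.
Qed.

(** Convergence at one nonzero point bounds the terms there, hence bounds the
    tails geometrically at half that distance. *)
Lemma taylor_of_series f z a :
  (\forall h \near (0 : C), series (fun n => a n * h ^+ n) @ \oo --> f (z + h)) ->
  taylor f z a.
Proof.
move=> /nbhs_cabs[e e0 He].
have He' : forall h, cabs h < e -> forall d : R, 0 < d -> forall N,
    exists m, cabs (psum a (N + m) h - f (z + h)) < d.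
  move=> h he d d0 N; have /He/cvgC_near/(_ d d0) : cabs (h - 0) < e by rewrite subr0.
  move=> [n0 _ Hn]; exists n0; have := Hn (N + n0)%N; rewrite /= leq_addl => /(_ isT).
  by rewrite /series /psum /= big_mkord.
pose r := e / 2; have r0 : 0 < r by rewrite /r; lra.
pose h0 : C := r%:C; have ch0 : cabs h0 = r by rewrite cabs_ofR gtr0_norm.
have [B B0 HB] : exists2 B : R, 0 <= B & forall n, cabs (a n * h0 ^+ n) <= B.
  have /He/cvgC_near/(_ 1 ltr01)[n0 _ Hn] : cabs (h0 - 0) < e by rewrite subr0 ch0 /r; lra.
  pose S := \sum_(i < n0) cabs (a i * h0 ^+ i).
  have S0 : 0 <= S by apply: sumr_ge0 => i _; exact: cabs_ge0.
  exists (2 + S); first lra.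
  move=> n; have [nn|nn] := leqP n0 n.
    have h1 := Hn n nn; have h2 := Hn n.+1 (leqW nn).
    rewrite /series /= !big_mkord in h1 h2.
    have -> : a n * h0 ^+ n = (psum a n.+1 h0 - f (z + h0)) - (psum a n h0 - f (z + h0)).
      by rewrite psumS; ring.
    by apply: le_trans (cabsD _ _) _; rewrite cabsN; rewrite /psum; lra.
  rewrite /S (bigD1 (Ordinal nn)) //=.
  have : 0 <= \sum_(i < n0 | i != Ordinal nn) cabs (a i * h0 ^+ i).
    by apply: sumr_ge0 => i _; exact: cabs_ge0.
  lra.
exists (2 * B), (2 / r); split; [lra|by rewrite divr_gt0|].
move=> N h Kh; have ch := cabs_ge0 h.
have qr : r^-1 * cabs h <= 1 / 2 by lra.
have q0 : 0 <= r^-1 * cabs h by rewrite mulr_ge0 // invr_ge0 ltW.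
have he : cabs h < e.
  have : cabs h <= r / 2.
    by move: qr; rewrite mulrC ler_pdivrMr // [1 / 2 * r]mulrC mulrA mulr1.
  rewrite /r; lra.
set q := r^-1 * cabs h in qr q0.
apply/ler_addgt0Pr => d d0; have [m Hm] := He' h he d d0 N.
have -> : f (z + h) - psum a N h = (psum a (N + m) h - psum a N h) - (psum a (N + m) h - f (z + h)) by ring.
apply: le_trans (cabsD _ _) _; rewrite cabsN; apply: lerD (ltW Hm).
rewrite psum_diff; apply: le_trans (cabs_sum _ _ _) _.
apply: le_trans (_ : \sum_(i < m) B * q ^+ (N + i) <= _).
  apply: ler_sum => i _; rewrite cabsM cabsX /q exprMn mulrA ler_wpM2r ?exprn_ge0 //.
  rewrite exprVn ler_pdivlMr ?exprn_gt0 // -ch0 -cabsX -cabsM; exact: HB.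
rewrite -mulr_sumr; apply: le_trans (ler_wpM2l B0 (geom_le N m _)) _.
  by rewrite q0 qr.
rewrite mulrA [B * 2]mulrC ler_wpM2l //; first lra.
have -> : 2 / r * cabs h = 2 * q by rewrite /q mulrA.
by apply: lerXn2r; rewrite ?nnegrE //; lra.
Qed.

Lemma series_of_taylor f z a : taylor f z a ->
  \forall h \near (0 : C), series (fun n => a n * h ^+ n) @ \oo --> f (z + h).
Proof.
move=> [M [K [M0 K0 H]]]; apply/nbhs_cabs; exists (1 / K); first by rewrite divr_gt0.
move=> h; rewrite subr0 ltr_pdivlMr // mulrC => Kh.
apply: cvgC => e e0.
have h0 : 0 <= K * cabs h by rewrite mulr_ge0 ?cabs_ge0 // ltW.
have : (fun n => M * (K * cabs h) ^+ n) @ \oo --> (M * 0 : R).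
  by apply: cvgMr; apply: cvg_expr; rewrite ger0_norm.
rewrite mulr0 => /cvgrPdist_lt/(_ e e0); apply: filterS => n /=.
rewrite sub0r normrN ger0_norm ?mulr_ge0 ?exprn_ge0 // => lt.
apply: le_lt_trans lt; rewrite cabsB /series /= big_mkord.
by apply: H; exact: ltW.
Qed.

End GermDivision.

(** * Derivatives of power-series germs *)

Section Derivatives.
Variable R : realType.
Local Notation C := (Cplx R).
Implicit Types (f g : C -> C) (z w h k : C) (a b : nat -> C) (M K q : R).

Lemma near0'P (A : set C) (e : R) : 0 < e ->
  (forall k, k != 0 -> cabs k < e -> A k) -> \forall k \near 0^', A k.
Proof.
move=> e0 H; apply/nbhs_cabs; exists e => // k; rewrite subr0 => ke k0.
exact: H.
Qed.

Lemma taylor_cvg f z a : taylor f z a ->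
  (fun k => k^-1 * (f (k + z) - f z)) @ 0^' --> a 1%N.
Proof.
move=> hf; have [M [K [M0 K0 H]]] := hf.
have fz := taylor_value hf.
apply: cvgC => e e0.
have D0 : 0 < M * K ^+ 2 + 1 by rewrite ltr_pwDr // mulr_ge0 // exprn_ge0 // ltW.
apply: (@near0'P _ (Num.min (1 / K) (e / (M * K ^+ 2 + 1)))).
  by rewrite lt_min !divr_gt0.
move=> k k0; rewrite lt_min => /andP[k1 k2].
have ck : 0 < cabs k by rewrite cabs_gt0.
have Kk : K * cabs k <= 1 by rewrite mulrC -ler_pdivlMr // ltW.
have := H 2%N k Kk; rewrite !psumS psum0 add0r expr0 mulr1 expr1 [k + z]addrC => hh.
rewrite -(ltr_pM2l ck) -cabsM mulrBr mulrA divff // mul1r fz.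
apply: le_lt_trans (_ : M * (K * cabs k) ^+ 2 < _).
  by rewrite (_ : _ - _ - _ = f (z + k) - (a 0%N + a 1%N * k)) //; ring.
move: k2; rewrite ltr_pdivlMr // => k2; rewrite exprMn; nra.
Qed.

Lemma taylor_derive1 f z a : taylor f z a -> (f^`())%classic z = a 1%N.
Proof.
move=> /taylor_cvg hf; rewrite /derive1; apply: cvg_lim => //.
Qed.

Lemma cvg_sum_ord (T : Type) (F : set_system T) (FF : Filter F) n
    (u : 'I_n -> T -> C) (l : 'I_n -> C) :
  (forall i, u i @ F --> l i) ->
  (fun x => \sum_(i < n) u i x) @ F --> \sum_(i < n) l i.
Proof.
elim: n u l => [|n IH] u l ul.
  under eq_fun do rewrite big_ord0.
  by rewrite big_ord0; exact: cvg_cst.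
under eq_fun do rewrite big_ord_recl.
by rewrite big_ord_recl; apply: cvgD => //; apply: IH.
Qed.

Lemma cvg_exprn (T : Type) (F : set_system T) (FF : Filter F) n (u : T -> C) (l : C) :
  u @ F --> l -> (fun x => u x ^+ n) @ F --> l ^+ n.
Proof.
move=> ul; elim: n => [|n IH]; first by under eq_fun do rewrite expr0; exact: cvg_cst.
by under eq_fun do rewrite exprS; rewrite exprS; apply: cvgM.
Qed.

Lemma psum_cvg a N h :
  (fun k => k^-1 * (psum a N.+1 (h + k) - psum a N.+1 h)) @ 0^' -->
   psum (fun n => a n.+1 *+ n.+1) N h.
Proof.
pose G k := \sum_(i < N) a i.+1 * \sum_(j < i.+1) (h + k) ^+ (i - j) * h ^+ j.
have GC : forall k : C, G x @[x --> k] --> G k.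
  move=> k; apply: (@cvg_sum_ord _ (nbhs k) _) => i.
  apply: cvgM; first exact: cvg_cst.
  apply: (@cvg_sum_ord _ (nbhs k) _) => j.
  apply: cvgM; last exact: cvg_cst.
  have c : h + x @[x --> k] --> h + k by exact: (@cvgD C C C (nbhs k) _ (fun=> h) id h k (cvg_cst h) cvg_id).
  exact: (@cvg_exprn _ (nbhs k)).
have -> : psum (fun n => a n.+1 *+ n.+1) N h = G 0.
  apply: eq_bigr => i _; rewrite addr0 mulrnAl -mulrnAr; congr (_ * _).
  rewrite -[X in _ *+ X]card_ord -sumr_const; apply: eq_bigr => j _.
  by rewrite -exprD subnK // -ltnS.
apply: cvg_trans (_ : G @ 0^' --> G 0); last first.
  by apply: cvg_trans (GC 0); apply: cvg_app; exact: cvg_within.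
apply: near_eq_cvg; apply: (@near0'P _ 1) => // k k0 _.
apply: (mulfI k0); rewrite mulVKf //.
rewrite /psum !big_ord_recl !expr0 opprD addrACA subrr add0r -sumrB mulr_sumr.
apply: eq_bigr => i _; rewrite -mulrBr subrXX addrAC subrr add0r mulrCA.
by congr (_ * (_ * _)); apply: eq_bigr => j _; rewrite subSS.
Qed.

(** The remainder is the limit of the tails of the power series, and x^n - y^n
    is x - y times a sum of n monomials of degree n - 1; the factor n is
    absorbed in 2^n. *)
Lemma remainder_lipschitz M K f z a : 0 <= M -> 0 < K -> taylor_bound M K f z a ->
  forall N h k, 4 * K * (cabs h + cabs k) <= 1 ->
  cabs ((f (z + (h + k)) - psum a N.+1 (h + k)) - (f (z + h) - psum a N.+1 h)) <=
  4 * M * K * cabs k * (2 * K * (cabs h + cabs k)) ^+ N.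
Proof.
move=> M0 K0 H N h k hk; have h0 := cabs_ge0 h; have k0 := cabs_ge0 k.
set s := cabs h + cabs k in hk *; have s0 : 0 <= s by rewrite addr_ge0.
set q := 2 * K * s; have q0 : 0 <= q by rewrite /q mulr_ge0 // mulr_ge0 // ltW.
have q2 : q <= 1 / 2 by rewrite /q; lra.
have Ks0 : 0 <= K * s by rewrite mulr_ge0 // ltW.
have hs : cabs h <= s by rewrite /s; lra.
have hks : cabs (h + k) <= s by exact: cabsD.
apply/ler_addgt0Pr => d d0.
have c0 : (fun m => M * (1/2) ^+ m + M * (1/2) ^+ m : R) @ \oo --> (M * 0 + M * 0 : R).
  have c1 : (fun m => (1/2) ^+ m : R) @ \oo --> (0 : R).
    by apply: cvg_expr; rewrite ger0_norm; lra.
  by apply: cvgD; apply: cvgMr.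
rewrite mulr0 addr0 in c0.
have [m Hm] : exists m, M * (1/2) ^+ m + M * (1/2) ^+ m <= d.
  move/cvgrPdist_le : c0 => /(_ d d0)[n0 _ /(_ n0 (leqnn _))] /=.
  by rewrite sub0r normrN => Hn; exists n0; exact: le_trans (ler_norm _) Hn.
have bnd : forall x, cabs x <= s -> cabs (f (z + x) - psum a (N.+1 + m) x) <= M * (1/2) ^+ m.
  move=> x xs; have x0 := cabs_ge0 x.
  have Kx0 : 0 <= K * cabs x by rewrite mulr_ge0 // ltW.
  have Kxs : K * cabs x <= K * s by rewrite ler_wpM2l // ltW.
  apply: le_trans (H _ _ _) _; first lra.
  rewrite ler_wpM2l // exprD -[leRHS]mul1r.
  apply: ler_pM; rewrite ?exprn_ge0 ?exprn_ile1 //; first lra.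
  by apply: lerXn2r; rewrite ?nnegrE //; lra.
have -> : (f (z + (h + k)) - psum a N.+1 (h + k)) - (f (z + h) - psum a N.+1 h) =
  ((psum a (N.+1 + m) (h + k) - psum a N.+1 (h + k)) -
   (psum a (N.+1 + m) h - psum a N.+1 h)) +
  ((f (z + (h + k)) - psum a (N.+1 + m) (h + k)) -
    (f (z + h) - psum a (N.+1 + m) h)) by ring.
apply: le_trans (cabsD _ _) _; apply: lerD; last first.
  apply: le_trans (cabsD _ _) _; rewrite cabsN; apply: le_trans Hm.
  by apply: lerD; exact: bnd.
rewrite !psum_diff -sumrB; apply: le_trans (cabs_sum _ _ _) _.
apply: le_trans (_ : \sum_(i < m) 2 * M * K * cabs k * q ^+ (N + i) <= _); last first.
  rewrite -mulr_sumr -/q.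
  have -> : 4 * M * K * cabs k * q ^+ N = 2 * M * K * cabs k * (2 * q ^+ N) by ring.
  apply: ler_wpM2l; last by rewrite geom_le // q0 q2.
  by rewrite !mulr_ge0 // ltW.
apply: ler_sum => i _; rewrite addSn; set n := (N + i)%N.
rewrite -mulrBr subrXX addrAC subrr add0r !cabsM.
have an := taylor_coef_le K0 H n.+1.
have st : cabs (\sum_(j < n.+1) (h + k) ^+ (n.+1.-1 - j) * h ^+ j) <= n.+1%:R * s ^+ n.
  apply: le_trans (cabs_sum _ _ _) _.
  rewrite mulr_natl -[X in _ *+ X]card_ord -sumr_const; apply: ler_sum => j _.
  rewrite cabsM !cabsX -[in s ^+ n](@subnK j n); last by rewrite -ltnS.
  rewrite exprD; apply: ler_pM; rewrite ?exprn_ge0 ?cabs_ge0 //.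
    by apply: lerXn2r; rewrite ?nnegrE ?cabs_ge0.
  by apply: lerXn2r; rewrite ?nnegrE ?cabs_ge0.
have n2 : n.+1%:R <= 2 ^+ n :> R by rewrite -natrX ler_nat ltn_expl.
have -> : 2 * M * K * cabs k * q ^+ n = (2 * M * K ^+ n.+1) * (cabs k * (2 ^+ n * s ^+ n)).
  by rewrite /q !exprMn exprS; ring.
apply: ler_pM; rewrite ?mulr_ge0 ?cabs_ge0 // ler_wpM2l //.
by apply: le_trans st _; rewrite ler_wpM2r // exprn_ge0.
Qed.

(** Dividing the Lipschitz bound on the remainder by k and letting k tend to 0
    bounds the difference between the derivative of f and the derivative of
    its Taylor polynomial. *)
Lemma taylor_deriv f z a : (\forall w \near z, exists b, taylor f w b) ->
  taylor f z a -> taylor ((f^`())%classic) z (fun n => a n.+1 *+ n.+1).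
Proof.
move=> /nbhs_cabs[e e0 He] [M [K [M0 K0 H]]].
exists (4 * M * K), (8 * K + 2 / e); split.
- by rewrite mulr_ge0 ?(ltW K0) //; lra.
- by rewrite addr_gt0 ?divr_gt0 //; lra.
move=> N h Kh; have h0 := cabs_ge0 h.
have Kh8 : 8 * K * cabs h <= 1.
  apply: le_trans Kh; rewrite ler_wpM2r // lerDl divr_ge0 // ltW //.
have he : cabs h < e.
  have : 2 / e * cabs h <= 1.
    by apply: le_trans Kh; rewrite ler_wpM2r // lerDr mulr_ge0 // ltW.
  rewrite mulrAC ler_pdivrMr //; lra.
have [b hb] : exists b, taylor f (z + h) b by apply: He; rewrite addrC addKr.
rewrite (taylor_derive1 hb).
have c1 := taylor_cvg hb; have c2 := @psum_cvg a N h.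
have c3 : (fun k => cabs (k^-1 * (f (k + (z + h)) - f (z + h)) -
   k^-1 * (psum a N.+1 (h + k) - psum a N.+1 h))) @ 0^' -->
   cabs (b 1%N - psum (fun n => a n.+1 *+ n.+1) N h).
  by apply: (cvg_comp _ _ (cvgB c1 c2)); exact: cabs_continuous.
pose B k : R := 4 * M * K * (2 * K * (cabs h + cabs k)) ^+ N.
have c4 : B @ 0^' --> B 0.
  apply: cvg_trans (_ : B @ 0 --> B 0); first by apply: cvg_app; exact: cvg_within.
  have c : 2 * K * (cabs h + cabs k) @[k --> (0 : C)] --> 2 * K * (cabs h + cabs (0 : C)).
    apply: (@cvgMr R C (nbhs (0 : C)) _).
    exact: (@cvgD R R C (nbhs (0 : C)) _ (fun=> cabs h) (@cabs R) _ _ (cvg_cst _) (@cabs_continuous R 0)).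
  apply: (@cvgMr R C (nbhs (0 : C)) _).
  exact: (cvg_comp _ (fun x : R => x ^+ N) c (@exprn_continuous R N _)).
apply: le_trans (_ : B 0 <= _); last first.
  rewrite /B cabs0 addr0; apply: ler_wpM2l; first by rewrite mulr_ge0 ?(ltW K0) //; lra.
  have : 0 <= 2 / e * cabs h by rewrite mulr_ge0 // divr_ge0 // ltW.
  have : 0 <= K * cabs h by rewrite mulr_ge0 // ltW.
  move=> ? ?; apply: lerXn2r; rewrite ?nnegrE ?mulrDl; lra.
apply: ler_cvg_to c3 c4 _.
apply: (@near0'P _ (1 / (8 * K))); first by rewrite divr_gt0 //; lra.
move=> k k0; have ck : 0 < cabs k by rewrite cabs_gt0.
rewrite ltr_pdivlMr => [kK|]; last lra.
rewrite -mulrBr cabsM cabsV -(ler_pM2l ck) mulrA divff ?mul1r ?gt_eqF //.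
have hk : 4 * K * (cabs h + cabs k) <= 1 by rewrite mulrDr; lra.
have := remainder_lipschitz M0 K0 H N hk.
rewrite (_ : z + (h + k) = k + (z + h)); last ring.
rewrite (_ : 4 * M * K * cabs k * _ = cabs k * B k); last by rewrite /B; ring.
apply: le_trans.
by rewrite (_ : _ - (_ - _) = f (k + (z + h)) - psum a N.+1 (h + k) -
  (f (z + h) - psum a N.+1 h)) //; ring.
Qed.

Definition hol f := forall z, disk z -> exists a, taylor f z a.

Lemma near_disk z : disk z -> \forall w \near z, disk w.
Proof.
rewrite diskE => z1; apply/nbhs_cabs; exists (1 - cabs z); first lra.
move=> w wz; rewrite diskE; have := cabs_subl w z; lra.
Qed.

Lemma hol_near f z : hol f -> disk z -> \forall w \near z, exists b, taylor f w b.
Proof. by move=> hf /near_disk; apply: filterS => w; exact: hf. Qed.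

Lemma hol_derive1 f : hol f -> hol ((f^`())%classic).
Proof.
move=> hf z zD; have [a ha] := hf z zD.
by exists (fun n => a n.+1 *+ n.+1); apply: taylor_deriv => //; exact: hol_near.
Qed.

Lemma derive3_taylor f z a : hol f -> disk z -> taylor f z a ->
  (f^`(3))%classic z = 6 * a 3%N.
Proof.
move=> hf zD ha.
have h1 := taylor_deriv (hol_near hf zD) ha.
have h2 := taylor_deriv (hol_near (hol_derive1 hf) zD) h1.
have h3 := taylor_derive1 h2.
change (((f^`())^`())^`() z = 6 * a 3%N)%classic; rewrite h3.
by rewrite !mulrS !mulr0n; ring.
Qed.

Lemma analytic_hol f : analytic_on (@disk R) f <-> hol f.
Proof.
split=> h z /h[a ha]; exists a; [exact: taylor_of_series|exact: series_of_taylor].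
Qed.

Lemma hol_continuous f z : hol f -> disk z -> {for z, continuous f}.
Proof.
move=> hf zD; have [a [M [K [M0 K0 H]]]] := hf z zD.
have fz : f z = a 0%N by apply: (@taylor_value _ f z a); exists M, K.
apply: (@cvgC _ _ (nbhs z) _ f (f z)) => e e0.
have D0 : 0 < M * K + 1 by have := mulr_ge0 M0 (ltW K0); lra.
apply/nbhs_cabs; exists (Num.min (1 / K) (e / (M * K + 1))).
  by rewrite lt_min !divr_gt0.
move=> w; rewrite lt_min => /andP[w1 w2].
have Kw : K * cabs (w - z) <= 1 by rewrite mulrC -ler_pdivlMr // ltW.
have := H 1%N (w - z) Kw.
rewrite (_ : z + (w - z) = w); last ring.
rewrite psumS psum0 add0r expr0 mulr1 expr1 -fz => /le_lt_trans; apply.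
by move: w2; rewrite ltr_pdivlMr //; have := cabs_ge0 (w - z); nra.
Qed.

End Derivatives.

(** * The maximum principle *)

Section MaximumPrinciple.
Variable R : realType.
Local Notation C := (Cplx R).
Implicit Types (f g : C -> C) (z w h k p : C) (a b : nat -> C) (M K q r : R).

Lemma unit_root z n : (0 < n)%N -> cabs z = 1 -> exists2 w : C, w ^+ n = z & cabs w = 1.
Proof.
move=> n0 z1; have wn : ((n.-root (z : R[i])) : C) ^+ n = z by exact: rootCK.
exists (n.-root (z : R[i])) => //.
apply/eqP; rewrite -(@pexpr_eq1 _ _ n) ?cabs_ge0 //.
by rewrite -cabsX wn z1.
Qed.

Lemma taylor_local_cst f z a : taylor f z a -> (forall n, a n.+1 = 0) ->
  \forall w \near z, f w = f z.
Proof.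
move=> hf a0; have fz := taylor_value hf; have [M [K [M0 K0 H]]] := hf.
apply/nbhs_cabs; exists (1 / (2 * K)); first by rewrite divr_gt0 // mulr_gt0.
move=> w; rewrite ltr_pdivlMr ?mulr_gt0 // => wK.
have h0 := cabs_ge0 (w - z).
have Kh : K * cabs (w - z) <= 1 / 2 by lra.
have Kh0 : 0 <= K * cabs (w - z) by rewrite mulr_ge0 // ltW.
apply/eqP; rewrite -subr_eq0 -cabs_eq0 eq_le cabs_ge0 andbT.
have c1 : (fun m => M * (1/2) ^+ m.+1 : R) @ \oo --> (M * 0 : R).
  apply: cvgMr; rewrite (cvg_shiftS (fun m => (1/2) ^+ m : R)).
  by apply: cvg_expr; rewrite ger0_norm; lra.
rewrite mulr0 in c1.
apply/ler_addgt0Pr => d d0; rewrite add0r.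
have [m Hm] : exists m, M * (1/2) ^+ m.+1 <= d.
  move/cvgrPdist_le : c1 => /(_ d d0)[n0 _ /(_ n0 (leqnn _))] /=.
  by rewrite sub0r normrN => Hn; exists n0; exact: le_trans (ler_norm _) Hn.
apply: le_trans Hm; have := H m.+1 (w - z).
rewrite (_ : z + (w - z) = w); last ring.
rewrite /psum big_ord_recl big1 => [|i _]; last by rewrite a0 mul0r.
rewrite expr0 mulr1 addr0 -fz => /(_ _)/le_trans -> //; first lra.
by apply: ler_wpM2l => //; apply: lerXn2r; rewrite ?nnegrE; lra.
Qed.

(** Suppose that f z is not 0 and that the series is not constant, and let k
    be the order of its first nonconstant term.  In a direction in which that
    term is a positive multiple of the constant term, the modulus of f
    increases to order k, and the remainder is of higher order. *)
Lemma local_max_cst f z a : taylor f z a ->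
  (\forall w \near z, cabs (f w) <= cabs (f z)) -> \forall w \near z, f w = f z.
Proof.
move=> hf hmax; have [fz0|fz0] := eqVneq (f z) 0.
  by move: hmax; apply: filterS => w; rewrite fz0 cabs0 => h; apply/eqP; rewrite -cabs_eq0 eq_le h cabs_ge0.
have [all0|] := pselect (forall n, a n.+1 = 0); first exact: taylor_local_cst hf all0.
move=> /existsNP ex; exfalso.
have ex' : exists n, a n.+1 != 0 by case: ex => n /eqP; exists n.
have [k0 ak kmin] := ex_minnP ex'; pose k := k0.+1.
have fz := taylor_value hf; rewrite fz in fz0.
have [M [K [M0 K0 H]]] := hf.
move/nbhs_cabs : hmax => [e e0 He].
have ca0 : 0 < cabs (a 0%N) by rewrite cabs_gt0.
have cak : 0 < cabs (a k) by rewrite cabs_gt0.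
(* In the direction w the term of order k is a positive multiple of a 0. *)
have [|w wk w1] := @unit_root ((a 0%N / a k) * (cabs (a k) / cabs (a 0%N))%:C) k isT.
  rewrite !cabsM cabsV cabs_ofR ger0_norm ?divr_ge0 ?(ltW cak) ?(ltW ca0) //.
  by field; rewrite !gt_eqF.
have D0 : 0 < M * K ^+ k.+1 + 1 by rewrite ltr_pwDr // mulr_ge0 // exprn_ge0 // ltW.
(* The last bound makes the remainder of order k + 1 smaller than the term of
   order k. *)
pose t := Num.min (e / 2) (Num.min (1 / K) (cabs (a k) / (M * K ^+ k.+1 + 1))).
have t0 : 0 < t by rewrite !lt_min !divr_gt0.
have te : t < e by apply: le_lt_trans (_ : e / 2 < e); [rewrite /t ge_min lexx|lra].
have tK : K * t <= 1.
  by rewrite mulrC -ler_pdivlMr // /t !ge_min lexx orbT.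
have tM : t * (M * K ^+ k.+1 + 1) <= cabs (a k).
  by rewrite -ler_pdivlMr // /t !ge_min lexx !orbT.
pose h := t%:C * w.
have ch : cabs h = t by rewrite cabsM w1 mulr1 cabs_ofR gtr0_norm.
have := He (z + h); rewrite addrAC subrr add0r ch => /(_ te); apply/negP.
rewrite -ltNge fz.
have tk : 0 < t ^+ k by rewrite exprn_gt0.
have ps : psum a k.+1 h = a 0%N * (1 + t ^+ k * (cabs (a k) / cabs (a 0%N)))%:C.
  rewrite /psum big_ord_recl big_ord_recr big1 => [|i _]; last first.
    rewrite /= /bump /=; case: (eqVneq (a (1 + i)%N) 0) => [->|ai]; first by rewrite mul0r.
    by have := kmin _ ai; rewrite leqNgt ltn_ord.
  rewrite /= add0r /bump /= add1n expr0 mulr1 -/k /h exprMn wk !ofRE.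
  by field; rewrite ofR_eq0 gt_eqF ?ak //.
have := H k.+1 h; rewrite ch => /(_ tK) bd.
have lb : cabs (psum a k.+1 h) = cabs (a 0%N) + t ^+ k * cabs (a k).
  rewrite ps cabsM cabs_ofR ger0_norm; last first.
    by rewrite addr_ge0 // mulr_ge0 ?(ltW tk) // divr_ge0 ?(ltW cak) ?(ltW ca0).
  by field; rewrite gt_eqF.
have := cabs_subl (psum a k.+1 h) (psum a k.+1 h - f (z + h)).
rewrite subKr cabsB lb => lb2.
have : M * (K * t) ^+ k.+1 < t ^+ k * cabs (a k); last lra.
rewrite exprMn [t ^+ k.+1]exprSr.
have -> : M * (K ^+ k.+1 * (t ^+ k * t)) = t ^+ k * (t * (M * K ^+ k.+1)) by ring.
by rewrite ltr_pM2l //; lra.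
Qed.

(** Convexity with weights in the real field; the weights in convex_set belong
    to the scalar field, here the complex numbers. *)
Definition real_convex (A : set C) := forall x y (t : R), A x -> A y ->
  0 <= t <= 1 -> A (t%:C * x + (1 - t)%:C * y).

Lemma line_continuous (p v : C) : continuous (fun t : R => p + t%:C * v).
Proof.
move=> t; have c := @ofR_continuous R t.
exact: (@cvgD C C R (nbhs t) _ (fun=> p) (fun t => t%:C * v) _ _ (cvg_cst p)
  (@cvgMl C R (nbhs t) _ _ _ v c)).
Qed.

Lemma real_convex_connected A : real_convex A -> connected A.
Proof.
move=> hA; have [->|/set0P[p Ap]] := eqVneq A set0; first exact: connected0.
pose S (y : C) := [set (p + t%:C * (y - p)) | t in `[0, 1]] : set C.
have -> : A = \bigcup_(y in A) S y.
  apply/seteqP; split => [y Ay|_ [y Ay [t t01 <-]]].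
    exists y => //; exists 1; first by rewrite /= in_itv /= lexx ler01.
    by rewrite mul1r addrC subrK.
  rewrite /= in_itv /= in t01.
  rewrite (_ : p + t%:C * (y - p) = t%:C * y + (1 - t)%:C * p); first exact: hA.
  by rewrite !ofRE; ring.
apply: bigcup_connected.
  exists p => y Ay; exists 0; first by rewrite /= in_itv /= lexx ler01.
  by rewrite mul0r addr0.
move=> y Ay; apply: connected_continuous_connected; first exact: segment_connected.
apply: continuous_subspaceT; exact: line_continuous.
Qed.

Lemma ball_real_convex r : real_convex [set z | cabs z < r].
Proof.
move=> x y t /= xr yr /andP[t0 t1].
apply: le_lt_trans (cabsD _ _) _; rewrite !cabsM !cabs_ofR (ger0_norm t0) ger0_norm; last lra.
have [->|tn] := eqVneq t 0; first by rewrite subr0 mul0r mul1r add0r.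
have : t * cabs x < t * r by rewrite ltr_pM2l // lt0r tn.
have : (1 - t) * cabs y <= (1 - t) * r by apply: ler_wpM2l; [lra|exact: ltW].
lra.
Qed.

(** The set where f takes the value f p is open by the local maximum principle
    and closed by continuity, in a connected disk. *)
Lemma max_cst f r p : hol f -> r <= 1 -> cabs p < r ->
  (forall z, cabs z < r -> cabs (f z) <= cabs (f p)) ->
  forall z, cabs z < r -> f z = f p.
Proof.
move=> hf r1 pr hmax.
pose A : set C := [set z | cabs z < r].
have AD z : A z -> disk z by rewrite /A /= diskE => h; exact: lt_le_trans h r1.
have Ao z : A z -> \forall w \near z, A w.
  rewrite /A /= => zr; apply/nbhs_cabs; exists (r - cabs z); first lra.
  by move=> w wz; have := cabs_subl w z; rewrite /=; lra.
pose B : set C := [set z | A z /\ f z = f p].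
suff BA : B = A by move=> z zr; have : A z by []; rewrite -BA => -[].
apply: (real_convex_connected (@ball_real_convex r)).
- by exists p.
- exists B; last by apply/seteqP; split => [z [? ?]|z [? ?]].
  rewrite openE => z [Az fz].
  have [a ha] := hf z (AD z Az).
  have loc : \forall w \near z, f w = f z.
    apply: (local_max_cst ha); move: (Ao z Az); apply: filterS => w Aw.
    by rewrite fz; exact: hmax.
  rewrite /interior /=; near=> w; split; first by near: w; exact: Ao.
  by rewrite -fz; near: w.
exists (closure B); first exact: closed_closure.
apply/seteqP; split => [z Bz|z [Az Bz]].
  by split; [case: Bz|exact: subset_closure].
split => //.
apply/eqP; rewrite -subr_eq0 -cabs_eq0 eq_le cabs_ge0 andbT.
apply/ler_addgt0Pr => d d0; rewrite add0r.
have := hol_continuous hf (AD z Az); move=> /cvgC_near/(_ d d0)/Bz[w [[_ fw] lt]].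
by rewrite -fw cabsB ltW.
Unshelve. all: by end_near. Qed.

Lemma compact_cdisk r : compact [set z : C | cabs z <= r].
Proof.
pose sq := `[- r, r]%classic `*` `[- r, r]%classic : set (R * R).
pose F (u : R * R) : C := Complex u.1 u.2.
apply: (@subclosed_compact _ _ (F @` sq)).
- have -> : [set z : C | cabs z <= r] = @cabs R @^-1` [set x | x <= r] by [].
  by apply: closed_comp => [z _|]; [exact: cabs_continuous|exact: closed_le].
- apply: continuous_compact.
    apply: continuous_subspaceT; apply: continuousC => u.
      exact: cvg_fst.
    exact: cvg_snd.
  by apply: compact_setX; exact: segment_compact.
move=> z /= zr; exists (re z, im z); last by rewrite /F /=; case: (z).
by split; rewrite /= in_itv /= -ler_norml; apply: le_trans zr; rewrite ?abs_re_le ?abs_im_le.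
Qed.

(** If the maximum over the closed disk is attained inside, then f is constant
    in the open disk, and by continuity takes the same value on the circle. *)
Lemma max_circle f r (B : R) : hol f -> 0 < r < 1 ->
  (forall z, cabs z = r -> cabs (f z) <= B) ->
  forall z, cabs z <= r -> cabs (f z) <= B.
Proof.
move=> hf /andP[r0 r1] hB z zr.
have AD w : cabs w <= r -> disk w by rewrite diskE => /le_lt_trans; exact.
have [||c cr cmax] := compact_EVT_max _ (@compact_cdisk r) (f := fun w => cabs (f w)).
- by exists z.
- apply: continuous_in_subspaceT => w; rewrite inE /= => wr.
  apply: (cvg_comp f (@cabs R)); [exact: hol_continuous (AD w wr)|exact: cabs_continuous].
rewrite inE /= in cr.
apply: le_trans (cmax z _) _; first by rewrite inE.
have := cr; rewrite le_eqVlt => /orP[/eqP/hB //|cr'].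
have cst : forall w, cabs w < r -> f w = f c.
  apply: (max_cst hf (ltW r1) cr') => w wr; apply: cmax; rewrite inE /=; exact: ltW.
have rr : cabs (r%:C : C) = r by rewrite cabs_ofR gtr0_norm.
apply/ler_addgt0Pr => d d0.
have [e e0 He] : exists2 e : R, 0 < e & forall w, cabs (w - r%:C) < e -> cabs (f w - f r%:C) < d.
  have /(hol_continuous hf)/cvgC_near/(_ d d0)/nbhs_cabs // : disk (r%:C : C).
  by apply: AD; rewrite rr.
pose m := Num.min r (e / 2); have m0 : 0 < m by rewrite lt_min r0 divr_gt0.
have mr : m <= r by rewrite /m ge_min lexx.
have me : m < e by apply: le_lt_trans (_ : e / 2 < e); [rewrite /m ge_min lexx orbT|lra].
have /He : cabs ((r - m)%:C - r%:C : C) < e.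
  by rewrite -ofRB cabs_ofR addrAC subrr sub0r normrN gtr0_norm.
rewrite cst; last by rewrite cabs_ofR ger0_norm; lra.
move=> lt; have := cabs_subl (f c) (f r%:C); have := hB _ rr; lra.
Qed.

End MaximumPrinciple.

(** * The Schur class of the disk *)

Section Schur.
Variable R : realType.
Local Notation C := (Cplx R).
Implicit Types (f g : C -> C) (z w h k p a : C) (r : R).

Lemma T_den_neq0 a z : cabs a < 1 -> cabs z <= 1 -> 1 + cconj a * z != 0.
Proof.
move=> a1 z1; rewrite -cabs_gt0.
have := cabs_subr 1 (cconj a * z); rewrite cabs1 cabsM cabs_conj.
have := cabs_ge0 a; have := cabs_ge0 z; nra.
Qed.

(** The identity behind all the mapping properties of T a. *)
Lemma T_defect a z : cabs (1 + cconj a * z) ^+ 2 - cabs (z + a) ^+ 2 =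
  (1 - cabs a ^+ 2) * (1 - cabs z ^+ 2).
Proof.
rewrite -ofR1 !cabs_sqr !reimE; ring.
Qed.

Lemma sqr1B_ge0 z : cabs z <= 1 -> 0 <= 1 - cabs z ^+ 2.
Proof. by move=> z1; have := cabs_ge0 z; nra. Qed.

Lemma sqr1B_gt0 z : cabs z < 1 -> 0 < 1 - cabs z ^+ 2.
Proof. by move=> z1; have := cabs_ge0 z; nra. Qed.

Lemma cabs_T a z : cabs (T a z) = cabs (z + a) / cabs (1 + cconj a * z).
Proof. by rewrite /T cabsM cabsV. Qed.

Lemma T_le1 a z : cabs a < 1 -> cabs z <= 1 -> cabs (T a z) <= 1.
Proof.
move=> a1 z1; have d0 := T_den_neq0 a1 z1; have td := T_defect a z.
have n0 := cabs_ge0 (z + a).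
rewrite -cabs_gt0 in d0; rewrite cabs_T ler_pdivrMr // mul1r.
have := mulr_ge0 (ltW (sqr1B_gt0 a1)) (sqr1B_ge0 z1); nra.
Qed.

Lemma conjM_neq1 a : cabs a < 1 -> 1 - cconj a * a != 0.
Proof.
move=> a1; rewrite [cconj a * a]mulrC mul_conj -ofR1 -ofRB ofR_eq0.
by rewrite gt_eqF // sqr1B_gt0.
Qed.

Lemma TK a z : cabs a < 1 -> cabs z <= 1 -> T (- a) (T a z) = z.
Proof.
move=> a1 z1; have d0 := T_den_neq0 a1 z1; have c0 := conjM_neq1 a1.
rewrite /T cconjN; field; rewrite d0 /=.
by rewrite (_ : _ + _ = 1 - cconj a * a) //; ring.
Qed.

Lemma TNK a z : cabs a < 1 -> cabs z <= 1 -> T a (T (- a) z) = z.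
Proof. by move=> a1 z1; rewrite -{1}[a]opprK TK // cabsN. Qed.

Lemma TN0 a : T (- a) a = 0. Proof. by rewrite /T subrr mul0r. Qed.

Lemma hol_cst (c : C) : hol (fun=> c).
Proof. by move=> z _; eexists; exact: taylor_cst. Qed.

Lemma hol_id : hol (@id C).
Proof. by move=> z _; eexists; exact: taylor_id. Qed.

Lemma holD f g : hol f -> hol g -> hol (fun z => f z + g z).
Proof. by move=> hf hg z zD; have [a ha] := hf z zD; have [b hb] := hg z zD; eexists; exact: taylorD ha hb. Qed.

Lemma holM f g : hol f -> hol g -> hol (fun z => f z * g z).
Proof. by move=> hf hg z zD; have [a ha] := hf z zD; have [b hb] := hg z zD; eexists; exact: taylorM ha hb. Qed.

Lemma holV f : hol f -> (forall z, disk z -> f z != 0) -> hol (fun z => (f z)^-1).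
Proof. by move=> hf f0 z zD; have [a ha] := hf z zD; eexists; exact: taylorV ha (f0 z zD). Qed.

Definition schur g := hol g /\ forall z, disk z -> cabs (g z) <= 1.

Lemma schur_T a g : cabs a < 1 -> schur g -> schur (fun z => T a (g z)).
Proof.
move=> a1 [hg g1]; split => [|z zD]; last exact: T_le1 (g1 z zD).
apply: holM; first exact: holD (hol_cst _).
apply: holV; first by apply: holD (hol_cst _) _; exact: holM (hol_cst _) _.
by move=> z zD; exact: T_den_neq0 (g1 z zD).
Qed.

Lemma schur_id : schur (@id C).
Proof. by split => [|z]; [exact: hol_id|rewrite diskE => /ltW]. Qed.

Lemma schurM f g : schur f -> schur g -> schur (fun z => f z * g z).
Proof.
move=> [hf f1] [hg g1]; split => [|z zD]; first exact: holM.
by rewrite cabsM mulr_ile1 ?cabs_ge0 ?f1 ?g1.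
Qed.

Lemma schur_cst (c : C) : cabs c <= 1 -> schur (fun=> c).
Proof. by split=> //; exact: hol_cst. Qed.

Lemma schur_max g p : schur g -> disk p -> cabs (g p) = 1 ->
  forall z, disk z -> g z = g p.
Proof.
move=> [hg g1] pD gp z; rewrite !diskE in pD *.
apply: (max_cst hg (lexx 1) pD) => w w1; rewrite gp; apply: g1; by rewrite diskE.
Qed.

(** Schwarz lemma with an automorphism in place of z.  On the circle of radius
    r the modulus of T (- p) tends to 1 as r tends to 1, so the bound on the
    product gives bounds on g on large circles as close to 1 as wanted, and
    the maximum principle carries them inside. *)
Lemma schwarz_quotient g p : hol g -> disk p ->
  (forall z, disk z -> cabs (T (- p) z * g z) <= 1) ->
  forall z, disk z -> cabs (g z) <= 1.
Proof.
move=> hg pD hT z zD; rewrite leNgt; apply/negP => gz1.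
have p1 : cabs p < 1 by rewrite -diskE.
have z1 : cabs z < 1 by rewrite -diskE.
have p0 := cabs_ge0 p; have z0 := cabs_ge0 z.
set m := cabs (g z) in gz1.
pose b := (1 + m) / 2; have b1 : 1 < b by rewrite /b; lra.
have bm : b < m by rewrite /b; lra.
(* On the circle of radius 1 - d with d <= e, the modulus of T (- p) exceeds 1
   / b. *)
pose e := (b ^+ 2 - 1) * (1 - cabs p) ^+ 2 / (2 * b ^+ 2).
have b2 : 1 < b ^+ 2 by nra.
have q2 : 0 < (1 - cabs p) ^+ 2 by rewrite exprn_gt0; lra.
have e0 : 0 < e by rewrite divr_gt0 // mulr_gt0; lra.
pose d := Num.min e ((1 - cabs z) / 2).
have d0 : 0 < d by rewrite lt_min e0 divr_gt0; lra.
have dz : d <= (1 - cabs z) / 2 by rewrite /d ge_min lexx orbT.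
have de : d <= e by rewrite /d ge_min lexx.
pose r := 1 - d.
have : m <= b; last lra.
apply: (@max_circle R g r b hg); [rewrite /r; lra| |rewrite /r; lra].
move=> w wr; have wD : disk w by rewrite diskE wr /r; lra.
have := hT w wD; rewrite cabsM cabs_T.
have np1 : cabs (- p) < 1 by rewrite cabsN.
have w1 : cabs w < 1 by rewrite -diskE.
have d1 := T_den_neq0 np1 (ltW w1).
rewrite -cabs_gt0 in d1.
have dl : 1 - cabs p <= cabs (1 + cconj (- p) * w).
  have := cabs_subr 1 (cconj (- p) * w); rewrite cabs1 cabsM cabs_conj cabsN.
  have : cabs w < 1 by rewrite -diskE.
  have := cabs_ge0 w; nra.
have td := T_defect (- p) w; rewrite cabsN wr in td.
set x := cabs (w - p) in td *; set y := cabs (1 + _) in d1 dl td *.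
rewrite mulrAC ler_pdivrMr // mul1r => xy.
have x0 : 0 <= x by exact: cabs_ge0.
have G0 : 0 <= cabs (g w) by exact: cabs_ge0.
rewrite leNgt; apply/negP => gb.
have xb : x * b <= y by apply: le_trans xy; rewrite ler_wpM2l // ltW.
have xb2 : x ^+ 2 * b ^+ 2 <= y ^+ 2.
  by rewrite -exprMn; apply: lerXn2r; rewrite ?nnegrE //; [rewrite mulr_ge0 //; lra|lra].
have r2 : 1 - r ^+ 2 < 2 * d by rewrite /r; nra.
have y2 : (1 - cabs p) ^+ 2 <= y ^+ 2 by apply: lerXn2r; rewrite ?nnegrE //; lra.
have pp : 0 < 1 - cabs p ^+ 2 <= 1 by apply/andP; split; nra.
have r20 : 0 < 1 - r ^+ 2 by rewrite /r; nra.
have t1 : y ^+ 2 - x ^+ 2 < 2 * e by nra.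
have t2 : 2 * e * b ^+ 2 = (b ^+ 2 - 1) * (1 - cabs p) ^+ 2.
  by rewrite /e; field; lra.
have t3 : (y ^+ 2 - x ^+ 2) * b ^+ 2 < 2 * e * b ^+ 2 by rewrite ltr_pM2r //; lra.
have t4 : (b ^+ 2 - 1) * (1 - cabs p) ^+ 2 <= (b ^+ 2 - 1) * y ^+ 2.
  by rewrite ler_wpM2l //; lra.
by move: t3 t4 xb2; rewrite t2; lra.
Qed.

(** At p itself the germ of the quotient is the divided germ; elsewhere it is
    a quotient of germs with nonvanishing denominator. *)
Lemma hol_divided g p : hol g -> disk p -> g p = 0 ->
  exists2 q : C -> C, hol q & forall z, g z = (z - p) * q z.
Proof.
move=> hg pD gp; have [a ha] := hg p pD.
pose q z := if z == p then a 1%N else g z / (z - p).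
have qE z : g z = (z - p) * q z.
  rewrite /q; case: eqVneq => [->|zp]; first by rewrite subrr mul0r.
  by rewrite mulrC divfK // subr_eq0.
exists q => // z zD; have [->|zp] := eqVneq z p.
  exists (fun n => a n.+1); apply: (taylor_shift ha) => [h h0|]; last by rewrite /q eqxx.
  by rewrite gp add0r qE addrAC subrr add0r.
have [b hb] := hg z zD.
have t1 : exists c, taylor (fun w => w - p) z c.
  by eexists; apply: taylorD (taylor_id _) (taylor_cst _ _).
have [c hc] := t1.
have zp0 : z - p != 0 by rewrite subr_eq0.
exists (cauchy_prod b (recip c)).
apply: taylor_near (taylorM hb (taylorV hc zp0)).
apply/nbhs_cabs; exists (cabs (z - p)); first by rewrite cabs_gt0.
move=> w; rewrite /q; case: eqVneq => [->|//]; by rewrite cabsB ltxx.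
Qed.

(** T (- g p) moves the value at p to 0, and the zero is then divided out.
    The factor 1 - conj p z turns division by z - p into division by T (- p).
    *)
Lemma schur_step g p : schur g -> disk p -> cabs (g p) < 1 ->
  exists2 h, schur h & forall z, disk z -> g z = T (g p) (T (- p) z * h z).
Proof.
move=> sg pD gp1; have p1 : cabs p < 1 by rewrite -diskE.
have np1 : cabs (- p) < 1 by rewrite cabsN.
have ngp1 : cabs (- g p) < 1 by rewrite cabsN.
have [hG G1] := schur_T ngp1 sg.
have [q hq qE] := hol_divided hG pD (TN0 _).
pose h z := (1 + cconj (- p) * z) * q z.
have hE z : disk z -> T (- p) z * h z = T (- g p) (g z).
  move=> zD; have z1 : cabs z <= 1 by move: zD; rewrite diskE => /ltW.
  have := qE z => /= ->; have := T_den_neq0 np1 z1.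
  by rewrite /h /T cconjN => d0; field.
have hh : hol h by apply: holM hq; apply: holD (hol_cst _) _; exact: holM (hol_cst _) hol_id.
exists h => [|z zD]; last by rewrite hE // TNK //; case: sg => _; apply.
split=> //; apply: schwarz_quotient hh pD _ => z zD.
by rewrite hE //; exact: G1.
Qed.

End Schur.

(** * Three-jets at a point of the disk *)

Section Jets.
Variable R : realType.
Local Notation C := (Cplx R).
Implicit Types (f g : C -> C) (z w h k p a : C) (x b : nat -> C) (r : R).

(** Lets ring derive an equation from another one that has the same difference
    of sides. *)
Lemma eq_of_subr (u v y z : C) : y = z -> u - v = y - z -> u = v.
Proof. by move=> ->; rewrite subrr => /eqP; rewrite subr_eq0 => /eqP. Qed.

Lemma cauchy_prod0 x b : cauchy_prod x b 0 = x 0%N * b 0%N.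
Proof. by rewrite /cauchy_prod big_ord1. Qed.

Lemma cauchy_prod1 x b : cauchy_prod x b 1 = x 0%N * b 1%N + x 1%N * b 0%N.
Proof. by rewrite /cauchy_prod !big_ord_recl big_ord0 addr0. Qed.

Lemma cauchy_prod2 x b : cauchy_prod x b 2 =
  x 0%N * b 2%N + x 1%N * b 1%N + x 2%N * b 0%N.
Proof. by rewrite /cauchy_prod !big_ord_recl big_ord0 addr0 addrA. Qed.

Lemma cauchy_prod3 x b : cauchy_prod x b 3 =
  x 0%N * b 3%N + x 1%N * b 2%N + x 2%N * b 1%N + x 3%N * b 0%N.
Proof. by rewrite /cauchy_prod !big_ord_recl big_ord0 addr0 !addrA. Qed.

Definition cauchy_prodE := (cauchy_prod0, cauchy_prod1, cauchy_prod2, cauchy_prod3).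

(** The expansion to third order of T a (x h + ...) for a germ x that vanishes
    at the base point. *)
Definition moebius_jet a x t :=
  [/\ t 0%N = a, t 1%N = (1 - a * cconj a) * x 1%N,
      t 2%N = (1 - a * cconj a) * (x 2%N - cconj a * x 1%N ^+ 2) &
      t 3%N = (1 - a * cconj a) * (x 3%N - 2 * cconj a * x 1%N * x 2%N
                                   + cconj a ^+ 2 * x 1%N ^+ 3) ].

Lemma taylor_T a g z x : cabs a < 1 -> schur g -> disk z -> taylor g z x -> x 0%N = 0 ->
  exists2 t, taylor (fun w => T a (g w)) z t & moebius_jet a x t.
Proof.
move=> a1 sg zD gx x0; have [/(_ z zD)[t ht] _] := schur_T a1 sg.
exists t => //.
have hd := taylorD (taylor_cst 1 z) (taylorM (taylor_cst (cconj a) z) gx).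
have hn := taylorD gx (taylor_cst a z).
have hp := taylorM ht hd.
have e : \forall w \near z, T a (g w) * (1 + cconj a * g w) = g w + a.
  move: (near_disk zD); apply: filterS => w wD.
  by rewrite /T divfK // T_den_neq0 //; case: sg => _; apply.
have eqn := taylor_unique (taylor_near e hp) hn.
have := eqn 0%N; have := eqn 1%N; have := eqn 2%N; have := eqn 3%N.
rewrite !cauchy_prodE x0 !(mulr0, mul0r, add0r, addr0, mulr1).
move=> e3 e2 e1 e0.
have t1 : t 1%N = (1 - a * cconj a) * x 1%N.
  by apply: (eq_of_subr e1); rewrite e0; ring.
rewrite t1 in e2 e3.
have t2 : t 2%N = (1 - a * cconj a) * (x 2%N - cconj a * x 1%N ^+ 2).
  by apply: (eq_of_subr e2); rewrite e0; ring.
rewrite t2 in e3.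
split => //; apply: (eq_of_subr e3); rewrite e0; ring.
Qed.

Lemma schurN_T p : disk p -> schur (T (- p)).
Proof. by rewrite diskE -cabsN => p1; apply: schur_T (schur_id R). Qed.

(** The expansion to third order of T (- p) at p. *)
Definition disk_jet p (x : nat -> C) :=
  let q := (1 - p * cconj p)^-1 in
  [/\ x 0%N = 0, x 1%N = q, x 2%N = cconj p * q ^+ 2 & x 3%N = cconj p ^+ 2 * q ^+ 3].

Lemma taylor_TN p : disk p -> exists2 x, taylor (T (- p)) p x & disk_jet p x.
Proof.
move=> pD; have [/(_ p pD)[x hx] _] := schurN_T pD; exists x => //.
have p1 : cabs p < 1 by rewrite -diskE.
have np1 : cabs (- p) < 1 by rewrite cabsN.
have hd := taylorD (taylor_cst 1 p) (taylorM (taylor_cst (cconj (- p)) p) (taylor_id p)).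
have hn := taylorD (taylor_id p) (taylor_cst (- p) p).
have e : \forall w \near p, T (- p) w * (1 + cconj (- p) * w) = w + - p.
  move: (near_disk pD); apply: filterS => w; rewrite diskE => wD.
  by rewrite /T divfK // T_den_neq0 // ltW.
have eqn := taylor_unique (taylor_near e (taylorM hx hd)) hn.
have q0 : 1 - p * cconj p != 0 by rewrite mulrC conjM_neq1.
have := eqn 0%N; have := eqn 1%N; have := eqn 2%N; have := eqn 3%N.
rewrite !cauchy_prodE !(mulr0, mul0r, add0r, addr0, mulr1) subrr cconjN => e3 e2 e1 e0.
have x0 : x 0%N = 0.
  by apply: (mulIf q0); rewrite mul0r; apply: (eq_of_subr e0); ring.
rewrite x0 in e1 e2 e3.
have x1 : x 1%N = (1 - p * cconj p)^-1.
  by apply: (mulIf q0); rewrite mulVf //; apply: (eq_of_subr e1); ring.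
rewrite x1 in e2 e3.
have x2 : x 2%N = cconj p * (1 - p * cconj p)^-1 ^+ 2.
  apply: (mulIf q0); apply: (eq_of_subr e2); field; exact: q0.
rewrite x2 in e3; split => //.
apply: (mulIf q0); apply: (eq_of_subr e3); field; exact: q0.
Qed.

Lemma taylor_step a p g b : cabs a < 1 -> disk p -> schur g -> taylor g p b ->
  exists2 t, taylor (fun w => T a (T (- p) w * g w)) p t &
    exists2 x, disk_jet p x & moebius_jet a (cauchy_prod x b) t.
Proof.
move=> a1 pD sg gb; have [x hx jx] := taylor_TN pD.
have y0 : cauchy_prod x b 0 = 0 by rewrite cauchy_prod0; case: jx => ->; rewrite mul0r.
have [t ht jt] := taylor_T a1 (schurM (schurN_T pD) sg) pD (taylorM hx gb) y0.
by exists t => //; exists x.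
Qed.

End Jets.

(** * The first two steps of the Schur algorithm *)

Section Decomposition.
Variables (R : realType) (r s : R) (lambda : Cplx R).
Hypotheses (s0 : 0 <= s) (sr : s < r) (r1 : r < 1) (cl1 : cabs lambda < 1).
Local Notation C := (Cplx R).
Implicit Types (f g h k : C -> C) (z w zeta : C).

Local Notation A := (constA r s).
Local Notation B := (constB r s lambda).
Local Notation K := (constC r s lambda).
Local Notation eta := (const_eta r s lambda).
Local Notation t := (const_t r s lambda).
Local Notation p := (r%:C : C).
Local Notation alpha := ((s / r)%:C : C).

Let r0 : 0 < r. Proof. exact: le_lt_trans s0 sr. Qed.

Lemma disk_p : disk p.
Proof. by rewrite diskE cabs_ofR gtr0_norm. Qed.

Lemma alpha_lt1 : cabs alpha < 1.
Proof. by rewrite cabs_ofR ger0_norm ?divr_ge0 // ?(ltW r0) // ltr_pdivrMr // mul1r. Qed.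

(** The functions obtained after the first two divisions, by z and by T (- r),
    that take the prescribed value at r. *)
Definition schur2 g z : C := z * T alpha (T (- r)%:C z * g z).
(** The same after a third division, when the derivative at r is prescribed
    too. *)
Definition schur3 h z : C := schur2 (fun w => T lambda (T (- r)%:C w * h w)) z.

Lemma H0_schur2 g : schur g -> H0 (schur2 g).
Proof.
move=> sg.
have [hS S1] : schur (fun z => T alpha (T (- r)%:C z * g z)).
  apply: schur_T alpha_lt1 _; apply: schurM sg; rewrite ofRN; exact: schurN_T disk_p.
split; last by rewrite /schur2 mul0r.
  by apply/analytic_hol; have := holM (@hol_id R) hS.
move=> _ [z zD <-]; rewrite diskE cabsM.
have := S1 z zD; have := zD; rewrite diskE.
have := cabs_ge0 z; set y := T _ _; have := cabs_ge0 y; nra.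
Qed.

Let p_neq0 : p != 0. Proof. by rewrite ofR_eq0 gt_eqF. Qed.
Let q_neq0 : 1 - p * p != 0.
Proof. by rewrite -ofRM -ofR1 -ofRB ofR_eq0 gt_eqF //; move: r0 r1; nra. Qed.

(** Multiplying by z shifts the jet of the Moebius transform; the value at r
    and the derivative at r depend on g only through g r. *)
Lemma taylor_schur2 g b : schur g -> taylor g p b -> exists2 a, taylor (schur2 g) p a &
  [/\ a 0%N = s%:C, a 1%N = alpha + p * (1 - alpha ^+ 2) / (1 - p ^+ 2) * b 0%N &
   exists2 x, disk_jet p x & let y := cauchy_prod x b in
    a 3%N = (1 - alpha ^+ 2) * (p * (y 3%N - 2 * alpha * y 1%N * y 2%N
                                   + alpha ^+ 2 * y 1%N ^+ 3)
       + y 2%N - alpha * y 1%N ^+ 2)].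
Proof.
move=> sg gb; have [u hu [x jx [u0 u1 u2 u3]]] := taylor_step alpha_lt1 disk_p sg gb.
have hf := taylorM (taylor_id p) hu.
rewrite cconj_ofR in u1 u2 u3.
exists (cauchy_prod (fun n => match n with 0%N => p | 1%N => 1 | _ => 0 end) u).
  by move: hf; rewrite /schur2 ofRN.
split; first by rewrite cauchy_prod0 u0 -ofRM mulrC divfK // gt_eqF.
  rewrite cauchy_prod1 u0 u1 cauchy_prod1; case: jx => -> -> _ _.
  by rewrite cconj_ofR; field; rewrite q_neq0.
exists x => //=; rewrite cauchy_prod3 u1 u2 u3; ring.
Qed.

Lemma H0_at_schur2 g : schur g -> g p = lambda -> H0_at r s lambda (schur2 g).
Proof.
move=> sg gl; have [b hb] := sg.1 p disk_p.
have [a ha [a0 a1 _]] := taylor_schur2 sg hb.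
split; first exact: H0_schur2.
  by rewrite (taylor_value ha).
rewrite (taylor_derive1 ha) a1 -(taylor_value hb) gl !ofRE; field.
by rewrite q_neq0 p_neq0.
Qed.

(** The derivative of f at r is a nonconstant affine function of g r, so
    prescribing it amounts to prescribing g r, and the constants are chosen so
    that the value is lambda. *)
Lemma schur2_of_H0_at f : H0_at r s lambda f -> exists g,
  [/\ schur g, g p = lambda & forall z, disk z -> f z = schur2 g z].
Proof.
move=> [[/analytic_hol hf fD f0] fp f'p].
have sf : schur f.
  by split=> // z zD; have : disk (f z) by [apply: fD; exists z]; rewrite diskE => /ltW.
have D0 : disk (0 : C) by rewrite diskE cabs0.
have [|g1 sg1 fg1] := schur_step sf D0; first by rewrite f0 cabs0.
have {}fg1 z : disk z -> f z = z * g1 z.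
  have c0 : cconj (0 : C) = 0 by exact: conjc0.
  by move=> /fg1 ->; rewrite f0 /T oppr0 c0 !mul0r !addr0 !divr1.
have g1p : g1 p = alpha.
  by apply: (mulfI p_neq0); rewrite -fg1 ?fp; [rewrite -ofRM mulrC divfK // gt_eqF|exact: disk_p].
have [|g sg g1g] := schur_step sg1 disk_p; first by rewrite g1p alpha_lt1.
have fg z : disk z -> f z = schur2 g z by move=> zD; rewrite /schur2 ofRN fg1 // g1g // g1p.
exists g; split => //.
have [b hb] := sg.1 p disk_p.
have [a ha [a0 a1 _]] := taylor_schur2 sg hb.
have hfa : taylor f p a.
  by apply: taylor_near ha; move: (near_disk disk_p); apply: filterS => z /fg ->.
have cE : ((r ^+ 2 - s ^+ 2) / (r * (1 - r ^+ 2)))%:C =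
    p * (1 - alpha ^+ 2) / (1 - p ^+ 2).
  by rewrite !ofRE; field; rewrite q_neq0 p_neq0.
have c0 : ((r ^+ 2 - s ^+ 2) / (r * (1 - r ^+ 2)))%:C != 0 :> C.
  by rewrite ofR_eq0 mulf_neq0 ?invr_eq0 ?mulf_neq0 // gt_eqF //; move: s0 sr r0 r1; nra.
move: f'p; rewrite (taylor_derive1 hfa) a1 -cE => /addrI/(mulfI c0).
by rewrite (taylor_value hb).
Qed.

End Decomposition.

(** * The values of the third derivative *)

Section ThirdDerivativeValues.
Variables (R : realType) (r s : R) (lambda : Cplx R).
Hypotheses (s0 : 0 <= s) (sr : s < r) (r1 : r < 1) (cl1 : cabs lambda < 1).
Local Notation C := (Cplx R).
Implicit Types (f g h k : C -> C) (z w zeta : C).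

Local Notation A := (constA r s).
Local Notation B := (constB r s lambda).
Local Notation K := (constC r s lambda).
Local Notation eta := (const_eta r s lambda).
Local Notation t := (const_t r s lambda).
Local Notation p := (r%:C : C).
Local Notation D := (denom r s lambda).
Local Notation F3 := (schur3 r s lambda).

Let r0 : 0 < r. Proof. exact: le_lt_trans s0 sr. Qed.
Let p_neq0 : p != 0. Proof. by rewrite ofR_eq0 gt_eqF. Qed.
Let q_neq0 : 1 - p * p != 0.
Proof. by rewrite -ofRM -ofR1 -ofRB ofR_eq0 gt_eqF //; move: r0 r1; nra. Qed.
Let pD : disk p. Proof. exact: disk_p s0 sr r1. Qed.

Lemma denom_neq0 : D != 0.
Proof.
rewrite -cabs_gt0; have := cabs_subl ((1 + r ^+ 2)%:C) ((2 * s)%:C * lambda).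
have n1 : 0 <= 1 + r ^+ 2 by have := sqr_ge0 r; lra.
have n2 : 0 <= 2 * s by move: s0; lra.
rewrite cabsM !cabs_ofR (ger0_norm n1) (ger0_norm n2).
by have := cabs_ge0 lambda; rewrite -/(denom r s lambda); move: s0 sr r0 r1 cl1; nra.
Qed.

Lemma constA_gt0 : 0 < 6 * (r ^+ 2 - s ^+ 2) / (r ^+ 3 * (1 - r ^+ 2) ^+ 3).
Proof.
have h1 : 0 < 1 - r ^+ 2 by move: r0 r1; nra.
have h2 : 0 < r ^+ 2 - s ^+ 2 by move: s0 sr r0; nra.
by rewrite divr_gt0 ?mulr_gt0 ?exprn_gt0.
Qed.

Lemma constA_neq0 : A != 0.
Proof. by rewrite ofR_eq0 gt_eqF // constA_gt0. Qed.

Lemma constC_neq0 : K != 0.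
Proof.
rewrite mulf_neq0 ?denom_neq0 // ofR_eq0 mulf_neq0 // gt_eqF //.
by rewrite sqr1B_gt0.
Qed.

Lemma const_t_gt0 : 0 < t.
Proof. by rewrite divr_gt0 // cabs_gt0 denom_neq0. Qed.

Lemma eta_lt_t : cabs eta < t.
Proof.
rewrite /const_eta /const_t cabsM cabsV cabsM cabs_ofR cabs_conj gtr0_norm //.
by rewrite -mulrA mulrCA gtr_pMl // divr_gt0 // cabs_gt0 denom_neq0.
Qed.

(** The phase of C, by which the parameter w of a disk of values differs from
    the value at r of the last Schur function. *)
Definition kappa : C := expi (arg K).

Lemma constC_polar : K * t%:C * cconj kappa = (r ^+ 2 * (1 - cabs lambda ^+ 2))%:C.
Proof.
rewrite {1}(argP constC_neq0) -/kappa mulrAC -[_ * kappa * _]mulrA expi_conj mulr1.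
rewrite -ofRM; congr ofR.
rewrite cabsM cabs_ofR ger0_norm; last first.
  by rewrite mulr_ge0 ?(ltW r0) // sqr1B_ge0 // ltW.
rewrite /const_t; field; by rewrite gt_eqF // cabs_gt0 denom_neq0.
Qed.

Lemma schur_Tstep g : schur g -> schur (fun z => T lambda (T (- r)%:C z * g z)).
Proof.
by move=> sg; apply: (schur_T cl1); apply: schurM sg; rewrite ofRN; exact: schurN_T.
Qed.

Lemma H0_at_schur3 h : schur h -> H0_at r s lambda (F3 h).
Proof.
move=> sh; apply: H0_at_schur2 => //; first exact: schur_Tstep.
by rewrite ofRN /T subrr !(mul0r, mulr0) addr0 add0r divr1.
Qed.

Lemma schur3_of_H0_at f : H0_at r s lambda f ->
  exists2 h, schur h & forall z, disk z -> f z = F3 h z.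
Proof.
move=> Hf; have [g [sg gl fg]] := schur2_of_H0_at s0 sr r1 Hf.
have [|h sh gh] := schur_step sg pD; first by rewrite gl.
by exists h => // z zD; rewrite fg // /schur3 /schur2 gh // gl ofRN.
Qed.

(** Two Moebius expansions are composed; what remains is an identity of
    rational functions, the definitions of A, B, C and eta being read off from
    it. *)
Lemma derive3_schur3 f h b : H0_at r s lambda f -> (forall z, disk z -> f z = F3 h z) ->
  schur h -> taylor h p b ->
  (f^`(3))%classic p = A * (B + K * c eta (b 0%N))
    + A * (r ^+ 2 * (1 - cabs lambda ^+ 2) * (1 - r ^+ 2))%:C * b 1%N.
Proof.
move=> [[/analytic_hol hf _ _] _ _] fh sh hb.
have [g hg [x [x0 x1 x2 x3] [g0 g1 g2 g3]]] := taylor_step cl1 pD sh hb.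
have sg := schur_Tstep sh.
have hg' : taylor (fun z => T lambda (T (- r)%:C z * h z)) p g by rewrite ofRN.
have [a ha [_ _ [x' [x0' x1' x2' x3'] a3]]] := taylor_schur2 s0 sr r1 sg hg'.
have hfa : taylor f p a.
  by apply: taylor_near ha; move: (near_disk pD); apply: filterS => z /fh ->.
rewrite /= in a3; rewrite (derive3_taylor hf pD hfa) a3.
rewrite !cauchy_prodE g0 g1 g2 !cauchy_prodE x0 x1 x2 x0' x1' x2' x3' !cconj_ofR.
have eE : eta = p * cconj lambda / D by [].
have KE : K = p * (1 - lambda * cconj lambda) * D.
  by rewrite /constC mul_conj !ofRE.
rewrite /c eE KE /constA /constB.
have -> : (r ^+ 2 * (1 - cabs lambda ^+ 2) * (1 - r ^+ 2))%:C =
   p ^+ 2 * (1 - lambda * cconj lambda) * (1 - p ^+ 2).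
  by rewrite mul_conj !ofRE.
have d0 := denom_neq0.
have DE : D = 1 + p ^+ 2 - 2 * s%:C * lambda by rewrite /denom !ofRE.
rewrite !ofRE.
set L := cconj lambda; set d := D in d0 DE *; set S := s%:C in DE *; set P := p in DE *.
rewrite DE in d0 *; field.
by rewrite d0 expr2 q_neq0 p_neq0.
Qed.

(** The points of V; zeta is the value at r of the third Schur function and w,
    up to the phase of C, that of the fourth one. *)
Definition value zeta w : C := A * (B + K * (c eta zeta + (rho t zeta)%:C * w)).

Definition schur_tail zeta k z : C := T zeta (T (- r)%:C z * k z).

Lemma schur_schur_tail zeta k : cabs zeta < 1 -> schur k -> schur (schur_tail zeta k).
Proof.
move=> z1 sk; apply: (schur_T z1); apply: schurM sk; rewrite ofRN; exact: schurN_T.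
Qed.

Lemma derive3_cst f zeta w : H0_at r s lambda f -> cabs zeta = 1 ->
  (forall z, disk z -> f z = F3 (fun=> zeta) z) ->
  (f^`(3))%classic p = value zeta w.
Proof.
move=> Hf z1 fE; have sz : schur (fun=> zeta) by apply: schur_cst; rewrite z1.
rewrite (derive3_schur3 Hf fE sz (taylor_cst zeta p)) mulr0 addr0 /value /rho z1.
by rewrite expr1n subrr mulr0 ofR0 mul0r addr0.
Qed.

Lemma derive3_tail f zeta k : H0_at r s lambda f -> cabs zeta < 1 -> schur k ->
  (forall z, disk z -> f z = F3 (schur_tail zeta k) z) ->
  (f^`(3))%classic p = value zeta (cconj kappa * k p).
Proof.
move=> Hf z1 sk fE; have st := schur_schur_tail z1 sk.
have [b hb] := sk.1 p pD.
have [g hg [x [x0 x1 _ _] [g0 g1 _ _]]] := taylor_step z1 pD sk hb.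
rewrite -ofRN in hg.
rewrite (derive3_schur3 Hf fE st hg) g0 g1 cauchy_prodE x0 x1 -(taylor_value hb) cconj_ofR.
have -> : (r ^+ 2 * (1 - cabs lambda ^+ 2) * (1 - r ^+ 2))%:C =
   K * t%:C * cconj kappa * (1 - r ^+ 2)%:C by rewrite constC_polar -ofRM.
rewrite /value /rho mul_conj !ofRE; field.
by rewrite q_neq0 andbT ofR_eq0 gt_eqF // cabs_gt0 denom_neq0.
Qed.

(** A Schur function either attains modulus 1 at r, and is constant, or admits
    one more Schur step. *)
Lemma schur_cases h : schur h ->
  (cabs (h p) = 1 /\ forall z, disk z -> h z = h p) \/
  (cabs (h p) < 1 /\ exists2 k, schur k & forall z, disk z -> h z = schur_tail (h p) k z).
Proof.
move=> sh; have := sh.2 p pD; rewrite le_eqVlt => /orP[/eqP e|lt]; [left|right].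
  by split=> // z zD; exact: schur_max.
by split=> //; have [k sk hk] := schur_step sh pD lt; exists k => // z /hk ->; rewrite /schur_tail ofRN.
Qed.

Lemma schur3_eq h k : (forall z, disk z -> h z = k z) ->
  forall z, disk z -> F3 h z = F3 k z.
Proof. by move=> hk z zD; rewrite /schur3 /schur2 hk. Qed.

(** In the first case the coefficient of w vanishes, so that any w, here 1,
    gives the same value. *)
Lemma H0_at_cases f : H0_at r s lambda f ->
  (exists zeta, [/\ cabs zeta = 1, (f^`(3))%classic p = value zeta 1 &
     forall z, disk z -> f z = F3 (fun=> zeta) z]) \/
  (exists zeta k, [/\ cabs zeta < 1, schur k, (f^`(3))%classic p = value zeta (cconj kappa * k p) &
     forall z, disk z -> f z = F3 (schur_tail zeta k) z]).
Proof.
move=> Hf; have [h sh fh] := schur3_of_H0_at Hf.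
have [[z1 hc]|[z1 [k sk hk]]] := schur_cases sh; [left|right].
  have fE z : disk z -> f z = F3 (fun=> h p) z.
    by move=> zD; rewrite fh //; apply: schur3_eq.
  by exists (h p); split => //; exact: derive3_cst.
have fE z : disk z -> f z = F3 (schur_tail (h p) k) z.
  by move=> zD; rewrite fh //; apply: schur3_eq.
by exists (h p), k; split => //; exact: derive3_tail.
Qed.

Lemma kappaK : kappa * cconj kappa = 1.
Proof. exact: expi_conj. Qed.

Lemma cabs_kappa : cabs kappa = 1.
Proof. exact: cabs_expi. Qed.

Lemma V_values :
  V r s lambda = [set v | exists zeta w, [/\ cabs zeta <= 1, cabs w <= 1 & v = value zeta w]].
Proof.
apply/seteqP; split => [_ [f Hf <-]|_ [zeta [w [z1 w1 ->]]]].
  have [[zeta [z1 -> _]]|[zeta [k [z1 sk -> _]]]] := H0_at_cases Hf.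
    by exists zeta, 1; rewrite z1 cabs1; split.
  exists zeta, (cconj kappa * k p); split => //; first exact: ltW.
  by rewrite cabsM cabs_conj cabs_kappa mul1r; exact: sk.2.
move: z1; rewrite le_eqVlt => /orP[/eqP z1|z1].
  have Hf : H0_at r s lambda (F3 (fun=> zeta)).
    by apply: H0_at_schur3; apply: schur_cst; rewrite z1.
  by exists (F3 (fun=> zeta)) => //; exact: derive3_cst.
have sk : schur (fun=> kappa * w) by apply: schur_cst; rewrite cabsM cabs_kappa mul1r.
have Hf := H0_at_schur3 (schur_schur_tail z1 sk).
exists (F3 (schur_tail zeta (fun=> kappa * w))) => //.
by rewrite (derive3_tail Hf z1 sk) // mulrA [cconj _ * _]mulrC kappaK mul1r.
Qed.

(** The point has this parameter zeta only, and for zeta inside the disk this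
    w only, since rho is then positive. *)
Definition exposed zeta w := forall zeta' w', cabs zeta' <= 1 -> cabs w' <= 1 ->
  value zeta' w' = value zeta w -> zeta' = zeta /\ (cabs zeta < 1 -> w' = w).

(** The fourth Schur function takes at r a value of modulus 1, so it is
    constant. *)
Lemma extremal_interior f zeta theta : H0_at r s lambda f -> cabs zeta < 1 ->
  exposed zeta (expi theta) ->
  (f^`(3))%classic p = value zeta (expi theta) <->
  (forall z, disk z -> f z = F3 (schur_tail zeta (fun=> expi (theta + arg K))) z).
Proof.
move=> Hf z1 ez; have sk : schur (fun=> expi (theta + arg K) : C).
  by apply: schur_cst; rewrite cabs_expi.
have kE : cconj kappa * expi (theta + arg K) = expi theta.
  by rewrite expiD -/kappa mulrCA [cconj _ * _]mulrC kappaK mulr1.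
split => [fv z zD|fE]; last by rewrite (derive3_tail Hf z1 sk fE) kE.
have [[zeta' [z1' f3 _]]|[zeta' [k [z1' sk' f3 fE]]]] := H0_at_cases Hf.
  have c1 : cabs zeta' <= 1 by rewrite z1'.
  have c2 : cabs (1 : C) <= 1 by rewrite cabs1.
  have [zz _] := ez _ _ c1 c2 (etrans (esym f3) fv).
  by move: z1; rewrite -zz z1' ltxx.
have w1 : cabs (cconj kappa * k p) <= 1.
  by rewrite cabsM cabs_conj cabs_kappa mul1r; exact: sk'.2.
have [zz /(_ z1) kp] := ez zeta' _ (ltW z1') w1 (etrans (esym f3) fv).
have kpE : k p = expi (theta + arg K).
  by rewrite expiD -kp -/kappa mulrAC [cconj _ * _]mulrC kappaK mul1r.
rewrite fE // -zz; apply: schur3_eq zD => {}z zD.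
rewrite /schur_tail -kpE (schur_max sk' pD) //.
by rewrite kpE cabs_expi.
Qed.

(** The third Schur function takes at r a value of modulus 1, so it is
    constant. *)
Lemma extremal_boundary f zeta w : H0_at r s lambda f -> cabs zeta = 1 ->
  cabs w <= 1 -> exposed zeta w ->
  (f^`(3))%classic p = value zeta w <->
  (forall z, disk z -> f z = F3 (fun=> zeta) z).
Proof.
move=> Hf z1 w1 ez; split => [fv z zD|fE]; last exact: derive3_cst.
have [[zeta' [z1' f3 fE]]|[zeta' [k [z1' sk' f3 fE]]]] := H0_at_cases Hf.
  have c1 : cabs zeta' <= 1 by rewrite z1'.
  have c2 : cabs (1 : C) <= 1 by rewrite cabs1.
  have [zz _] := ez _ _ c1 c2 (etrans (esym f3) fv).
  by rewrite fE // zz.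
have w1' : cabs (cconj kappa * k p) <= 1.
  by rewrite cabsM cabs_conj cabs_kappa mul1r; exact: sk'.2.
have [zz _] := ez zeta' _ (ltW z1') w1' (etrans (esym f3) fv).
by move: z1'; rewrite zz z1 ltxx.
Qed.

End ThirdDerivativeValues.

(** * The extremal points in a given direction *)

Section Extremal.
Variables (R : realType) (eta : Cplx R) (t : R).
Hypothesis eta_lt : cabs eta < t.
Local Notation C := (Cplx R).
Implicit Types (theta x : R) (z w d zeta : C).

(** The support function, in the direction theta, of the disk of centre c zeta
    and radius x (1 - |zeta|^2). *)
Definition phi x theta zeta : R :=
  re (cconj (expi theta) * c eta zeta) + x * (1 - cabs zeta ^+ 2).

(** The critical point of phi x theta on the whole plane, for x > |eta|. *)
Definition crit x theta : C :=
  (x%:C * expi theta - cconj eta) / (2 * (x ^+ 2 - cabs eta ^+ 2))%:C.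

Lemma crit_den x : cabs eta < x -> 0 < 2 * (x ^+ 2 - cabs eta ^+ 2).
Proof. by move=> hx; have := cabs_ge0 eta; nra. Qed.

Lemma crit_eq x theta : cabs eta < x ->
  expi theta * (1 - 2 * cconj (eta * crit x theta)) = (2 * x)%:C * crit x theta.
Proof.
move=> hx; have d0 := crit_den hx.
have e1 := expi_conj theta; have n0 := mul_conj eta.
have dn : x%:C ^+ 2 - eta * cconj eta != 0.
  by rewrite n0 -ofRX -ofRB ofR_eq0; apply/eqP => h; move: d0; rewrite h mulr0 ltxx.
have cc : cconj (crit x theta) =
    (x%:C * cconj (expi theta) - eta) / (2 * (x ^+ 2 - cabs eta ^+ 2))%:C.
  by rewrite cconjM cconjV cconj_ofR cconjD cconjN cconjK cconjM cconj_ofR.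
rewrite cconjM cc /crit.
have -> : (2 * (x ^+ 2 - cabs eta ^+ 2))%:C = 2 * (x%:C ^+ 2 - eta * cconj eta) :> C.
  by rewrite n0 !ofRE.
set e := expi theta in e1 *; set L := cconj eta in dn *; set e' := cconj e in e1 *.
rewrite ofRM ofRn.
have -> : e * (1 - 2 * (L * ((x%:C * e' - eta) / (2 * (x%:C ^+ 2 - eta * L))))) =
  (e * (x%:C ^+ 2 - eta * L) - L * (x%:C * (e * e') - eta * e)) / (x%:C ^+ 2 - eta * L).
  by field.
by rewrite e1; field.
Qed.

(** Around its critical point phi is a quadratic form: minus x |d|^2, plus a
    perturbation of modulus at most |eta| |d|^2 that comes from the curvature
    of c. *)
Lemma phi_crit x theta zeta : cabs eta < x ->
  phi x theta zeta + (x - cabs eta) * cabs (zeta - crit x theta) ^+ 2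
  <= phi x theta (crit x theta).
Proof.
move=> hx; have ce := crit_eq theta hx; set z0 := crit x theta in ce *.
set d := zeta - z0; set e := expi theta in ce *.
have {}ce : cconj e * (1 - 2 * (eta * z0)) = (2 * x)%:C * cconj z0.
  have := congr1 (@cconj R) ce; rewrite cconjM cconjD cconj1 cconjN [cconj (2 * _)]cconjM cconjK [in RHS]cconjM cconj_ofR.
  by rewrite cconj_nat.
have zE : zeta = z0 + d by rewrite /d addrC subrK.
have cE : cconj e * c eta zeta = cconj e * c eta z0 + (2 * x)%:C * (cconj z0 * d)
    - cconj e * eta * d ^+ 2.
  by rewrite mulrA -ce zE /c; ring.
have nE : cabs zeta ^+ 2 = cabs z0 ^+ 2 + 2 * re (cconj z0 * d) + cabs d ^+ 2.
  by rewrite !cabs_sqr zE !reimE; ring.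
have rE : - re (cconj e * eta * d ^+ 2) <= cabs eta * cabs d ^+ 2.
  rewrite -reN; apply: le_trans (re_le_cabs _) _.
  by rewrite cabsN cabsM cabsX cabsM cabs_conj cabs_expi mul1r.
rewrite /phi cE nE reD reN reD [re ((2 * x)%:C * _)]reM re_ofR im_ofR mul0r subr0.
lra.
Qed.

(** The equation of the critical point determines the parameter x, as long as
    the point is not 0. *)
Lemma crit_inj x y theta : cabs eta < x -> cabs eta < y ->
  crit x theta = crit y theta -> crit x theta != 0 -> x = y.
Proof.
move=> hx hy e n0; have ex := crit_eq theta hx; have ey := crit_eq theta hy.
move: ey; rewrite -e ex => /(mulIf n0)/(congr1 (@re R)); rewrite !re_ofR; lra.
Qed.

Lemma phi_shift x y theta zeta :
  phi y theta zeta = phi x theta zeta + (y - x) * (1 - cabs zeta ^+ 2).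
Proof. by rewrite /phi; ring. Qed.

Lemma cabs_crit x theta : cabs eta < x ->
  cabs (crit x theta) = cabs (x%:C * expi theta - cconj eta) / (2 * (x ^+ 2 - cabs eta ^+ 2)).
Proof.
by move=> hx; rewrite cabsM cabsV cabs_ofR ger0_norm // ltW // crit_den.
Qed.

(** On the circle phi does not depend on the parameter.  If x < t, then the
    critical point for t, lying outside the open disk, would be at least as
    good for x as the critical point for x, so the two coincide. *)
Lemma crit_unit_ge x theta : cabs eta < x -> cabs (crit x theta) = 1 ->
  1 <= cabs (crit t theta) -> t <= x.
Proof.
move=> hx c1 ct; rewrite leNgt; apply/negP => xt.
have h1 := phi_crit theta (crit t theta) hx.
have h2 := phi_crit theta (crit x theta) eta_lt.
rewrite (phi_shift x t) (phi_shift x t theta (crit t theta)) c1 in h2.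
have h3 : 0 <= (t - x) * (cabs (crit t theta) ^+ 2 - 1) by apply: mulr_ge0; nra.
rewrite cabsB in h2; set s := cabs (_ - _) in h1 h2.
have s2 : 0 <= s ^+ 2 by exact: sqr_ge0.
have p1 : 0 <= (x - cabs eta) * s ^+ 2 by apply: mulr_ge0; lra.
have p2 : (t - cabs eta) * s ^+ 2 <= 0 by nra.
have s0 : s ^+ 2 = 0.
  apply/eqP; rewrite eq_le s2 andbT -(@pmulr_rle0 _ (t - cabs eta)) //; lra.
have : crit t theta = crit x theta.
  by apply/eqP; rewrite -subr_eq0 -cabs_eq0 -/s -sqrf_eq0 s0.
move=> e; have : t = x.
  by apply: (crit_inj eta_lt hx e); rewrite -cabs_gt0; lra.
lra.
Qed.

(** Intermediate value theorem between t and a large parameter; at |eta| + 1 /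
    2 and beyond, the triangle inequality already gives the reversed
    inequality. *)
Lemma crit_unit_exists theta :
  2 * (t ^+ 2 - cabs eta ^+ 2) <= cabs (t%:C * expi theta - cconj eta) ->
  exists x, cabs eta < x /\
     cabs (x%:C * expi theta - cconj eta) = 2 * (x ^+ 2 - cabs eta ^+ 2).
Proof.
move=> ht; have n0 := cabs_ge0 eta.
pose F x := cabs (x%:C * expi theta - cconj eta) - 2 * (x ^+ 2 - cabs eta ^+ 2).
have Fc : continuous F.
  pose G x := cabs (- cconj eta + x%:C * expi theta).
  have Gc : continuous G.
    move=> x; exact: (cvg_comp _ _ (@line_continuous R _ _ x) (@cabs_continuous R _)).
  have -> : F = fun x => G x - 2 * (x ^+ 2 - cabs eta ^+ 2).
    by apply/funext => y; rewrite /F /G [_ - cconj eta]addrC.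
  move=> x; apply: cvgB; first exact: Gc.
  apply: cvgMr; apply: cvgB; last exact: cvg_cst.
  exact: exprn_continuous.
(* Beyond |eta| + 1 / 2 one has 2 (x - |eta|) >= 1. *)
pose X := Num.max t (cabs eta + 1 / 2).
have tX : t <= X by rewrite le_max lexx.
have eX : cabs eta + 1 / 2 <= X by rewrite le_max lexx orbT.
have FX : F X <= 0.
  rewrite /F; have := cabsD (X%:C * expi theta) (- cconj eta).
  have X0 : 0 <= X by lra.
  rewrite cabsM cabs_ofR cabs_expi cabsN cabs_conj mulr1 ger0_norm // => h.
  have : 0 <= (X + cabs eta) * (2 * (X - cabs eta) - 1) by apply: mulr_ge0; lra.
  move: h; set y := cabs (_ - _); nra.
have Ft : 0 <= F t by rewrite /F; lra.
have [||x xI Fx] := @IVT R F t X 0 tX.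
- exact: continuous_subspaceT.
- by rewrite ge_min FX orbT le_max Ft.
exists x; move: xI; rewrite in_itv /= => /andP[tx _]; split; first exact: lt_le_trans eta_lt tx.
by move: Fx; rewrite /F; lra.
Qed.

Lemma zetaE theta : zeta_ eta t theta = crit (t_ eta t theta) theta.
Proof. by []. Qed.

Lemma t_outer theta :
  2 * (t ^+ 2 - cabs eta ^+ 2) <= cabs (t%:C * expi theta - cconj eta) ->
  cabs eta < t_ eta t theta /\ cabs (zeta_ eta t theta) = 1.
Proof.
move=> ht; rewrite zetaE /t_ ht.
pose P x := cabs eta < x /\
  cabs (x%:C * expi theta - cconj eta) = 2 * (x ^+ 2 - cabs eta ^+ 2).
have [hx xe] : P (get P) by apply: getPex; exact: crit_unit_exists.
by split => //; rewrite cabs_crit // xe divff // gt_eqF // crit_den.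
Qed.

Lemma t_inner theta :
  cabs (t%:C * expi theta - cconj eta) < 2 * (t ^+ 2 - cabs eta ^+ 2) ->
  t_ eta t theta = t.
Proof. by rewrite /t_ leNgt => ->. Qed.

(** Complementary slackness: either the constraint |zeta| <= 1 is active, or
    the parameter is the original t. *)
Lemma t_spec theta : t <= t_ eta t theta /\
  (cabs (zeta_ eta t theta) = 1 \/ (t_ eta t theta = t /\ cabs (zeta_ eta t theta) < 1)).
Proof.
have [ht|ht] := leP (2 * (t ^+ 2 - cabs eta ^+ 2)) (cabs (t%:C * expi theta - cconj eta)).
  have [hx c1] := t_outer ht; split; last by left.
  by apply: (crit_unit_ge hx c1); rewrite cabs_crit // ler_pdivlMr ?mul1r // crit_den.
rewrite zetaE (t_inner ht); split=> //; right; split => //.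
by rewrite cabs_crit // ltr_pdivrMr ?mul1r // crit_den.
Qed.

Lemma zeta_le1 theta : cabs (zeta_ eta t theta) <= 1.
Proof. by have [_ [->|[_ /ltW]]] := t_spec theta. Qed.

(** Raising the parameter from t to t_theta only increases phi on the disk,
    and does not change its value at zeta_theta. *)
Lemma zeta_max theta zeta : cabs zeta <= 1 ->
  phi t theta zeta + (t - cabs eta) * cabs (zeta - zeta_ eta t theta) ^+ 2
  <= phi t theta (zeta_ eta t theta).
Proof.
move=> z1; have [tx hc] := t_spec theta.
have hx : cabs eta < t_ eta t theta by exact: lt_le_trans eta_lt tx.
have := phi_crit theta zeta hx; rewrite -zetaE.
set x := t_ eta t theta in tx hc hx *; set z0 := zeta_ eta t theta in hc *.
rewrite (phi_shift t x) (phi_shift t x theta z0).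
have -> : (x - t) * (1 - cabs z0 ^+ 2) = 0.
  by case: hc => [->|[-> _]]; rewrite ?expr1n subrr ?mulr0 ?mul0r.
have h1 : 0 <= (x - t) * (1 - cabs zeta ^+ 2) by rewrite mulr_ge0 ?sqr1B_ge0 //; lra.
have : 0 <= (x - t) * cabs (zeta - z0) ^+ 2 by rewrite mulr_ge0 ?sqr_ge0 //; lra.
lra.
Qed.

(** Each of the two maximizers is compared with the other one by zeta_max.  In
    the sum of the two inequalities only the difference of the two directions
    is left on the right, paired with the difference of two values of c. *)
Lemma zeta_lipschitz theta theta' :
  2 * (t - cabs eta) * cabs (zeta_ eta t theta - zeta_ eta t theta') <=
  (1 + 2 * cabs eta) * cabs (expi theta - expi theta' : C).
Proof.
have h1 := zeta_max theta (zeta_le1 theta').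
have h2 := zeta_max theta' (zeta_le1 theta).
set z := zeta_ eta t theta in h1 h2 *; set z' := zeta_ eta t theta' in h1 h2 *.
have z1 : cabs z <= 1 := zeta_le1 theta.
have z1' : cabs z' <= 1 := zeta_le1 theta'.
rewrite cabsB in h1; set d := cabs (z - z') in h1 h2 *.
have d0 : 0 <= d by exact: cabs_ge0.
have [->|dn] := eqVneq d 0.
  by rewrite mulr0 mulr_ge0 ?cabs_ge0 //; have := cabs_ge0 eta; lra.
have dp : 0 < d by rewrite lt0r dn.
have key : phi t theta z - phi t theta z' + (phi t theta' z' - phi t theta' z) =
  re (cconj (expi theta - expi theta') * (c eta z - c eta z')).
  by rewrite cconjD cconjN mulrDl mulNr !mulrDr !mulrN /phi !(reD, reN); ring.
have cl : cabs (c eta z - c eta z') <= d * (1 + 2 * cabs eta).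
  rewrite (_ : _ - _ = (z - z') * (1 - eta * (z + z'))); last by rewrite /c; ring.
  rewrite cabsM ler_wpM2l //; apply: le_trans (cabsD _ _) _; rewrite cabs1 cabsN cabsM lerD2l.
  have := cabsD z z'; have := cabs_ge0 eta; nra.
have rl := re_le_cabs (cconj (expi theta - expi theta') * (c eta z - c eta z')).
rewrite cabsM cabs_conj in rl.
set E := cabs (expi theta - expi theta') in rl *.
have E0 : 0 <= E by exact: cabs_ge0.
have : E * cabs (c eta z - c eta z') <= E * (d * (1 + 2 * cabs eta)) by rewrite ler_wpM2l.
rewrite -(ler_pM2l dp); nra.
Qed.

Lemma zeta_continuous : continuous (zeta_ eta t).
Proof.
move=> x; apply: (@cvgC _ _ (nbhs x) _ _ (zeta_ eta t x)) => e e0.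
have te : 0 < 2 * (t - cabs eta) by move: eta_lt; lra.
have ce : 0 < 1 + 2 * cabs eta by move: eta_lt (cabs_ge0 eta); lra.
have d0 : 0 < e * (2 * (t - cabs eta)) / (1 + 2 * cabs eta) by rewrite divr_gt0 // mulr_gt0.
have := cvgC_near (nbhs_filter x) (@expi_continuous R x) d0; apply: filterS => y.
rewrite ltr_pdivlMr // => h.
by rewrite -(ltr_pM2l te) [ltRHS]mulrC; apply: le_lt_trans h; rewrite [leRHS]mulrC; exact: zeta_lipschitz.
Qed.

Definition gamma theta : C :=
  c eta (zeta_ eta t theta) + (rho t (zeta_ eta t theta))%:C * expi theta.

Lemma rho_ge0 zeta : cabs zeta <= 1 -> 0 <= rho t zeta.
Proof.
by move=> z1; rewrite mulr_ge0 ?sqr1B_ge0 //; move: eta_lt (cabs_ge0 eta); lra.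
Qed.

Lemma re_conj_expi_le theta w : cabs w <= 1 -> re (cconj (expi theta) * w) <= 1.
Proof.
move=> w1; apply: le_trans (re_le_cabs _) _.
by rewrite cabsM cabs_conj cabs_expi mul1r.
Qed.

Lemma re_conj_expi_eq theta w : cabs w <= 1 -> 1 <= re (cconj (expi theta) * w) -> w = expi theta.
Proof.
move=> w1 h; have h1 := re_le_cabs (cconj (expi theta) * w).
have c1 : cabs (cconj (expi theta) * w) <= 1 by rewrite cabsM cabs_conj cabs_expi mul1r.
have e : re (cconj (expi theta) * w) = cabs (cconj (expi theta) * w) by lra.
have := re_eq_cabs e; have -> : cabs (cconj (expi theta) * w) = 1 by lra.
by move=> e1; rewrite -[RHS]mulr1 -ofR1 -e1 mulrA expi_conj mul1r.
Qed.

Lemma support_gamma theta : re (cconj (expi theta) * gamma theta) = phi t theta (zeta_ eta t theta).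
Proof.
rewrite /gamma mulrDr reD [cconj _ * (_%:C * _)]mulrCA [cconj _ * expi _]mulrC expi_conj mulr1 re_ofR.
by rewrite /phi /rho.
Qed.

Lemma support_le theta zeta w : cabs zeta <= 1 -> cabs w <= 1 ->
  re (cconj (expi theta) * (c eta zeta + (rho t zeta)%:C * w)) <= phi t theta zeta.
Proof.
move=> z1 w1; rewrite mulrDr reD [cconj _ * (_%:C * _)]mulrCA [re (_%:C * _)]reM re_ofR im_ofR mul0r subr0.
rewrite /phi -/(rho t zeta) lerD2l.
by rewrite -[leRHS]mulr1 ler_wpM2l ?rho_ge0 ?re_conj_expi_le.
Qed.

Lemma gamma_support theta zeta w : cabs zeta <= 1 -> cabs w <= 1 ->
  re (cconj (expi theta) * (c eta zeta + (rho t zeta)%:C * w)) <=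
  re (cconj (expi theta) * gamma theta).
Proof.
move=> z1 w1; apply: le_trans (support_le theta z1 w1) _; rewrite support_gamma.
have := zeta_max theta z1.
have : 0 <= (t - cabs eta) * cabs (zeta - zeta_ eta t theta) ^+ 2.
  by rewrite mulr_ge0 ?sqr_ge0 //; move: eta_lt; lra.
lra.
Qed.

Lemma gamma_exposed theta zeta w : cabs zeta <= 1 -> cabs w <= 1 ->
  re (cconj (expi theta) * gamma theta) <=
    re (cconj (expi theta) * (c eta zeta + (rho t zeta)%:C * w)) ->
  zeta = zeta_ eta t theta /\ (cabs (zeta_ eta t theta) < 1 -> w = expi theta).
Proof.
move=> z1 w1; rewrite support_gamma => h.
have h1 := support_le theta z1 w1.
have h2 := zeta_max theta z1.
have ze : zeta = zeta_ eta t theta.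
  apply/eqP; rewrite -subr_eq0 -cabs_eq0 -sqrf_eq0.
  rewrite eq_le sqr_ge0 andbT -(@pmulr_rle0 _ (t - cabs eta)); move: eta_lt; lra.
split => // lt1; rewrite -ze in h lt1.
apply: re_conj_expi_eq => //.
have rp : 0 < rho t zeta by rewrite mulr_gt0 ?sqr1B_gt0 //; move: eta_lt (cabs_ge0 eta); lra.
rewrite -(ler_pM2l rp) mulr1.
move: h; rewrite mulrDr reD [cconj _ * (_%:C * _)]mulrCA [re (_%:C * _)]reM re_ofR im_ofR mul0r subr0.
by rewrite /phi -/(rho t zeta) lerD2l.
Qed.

(** A point exposed in two directions has the same zeta in both.  Inside the
    disk w is the direction; on the circle the directions agree up to a
    positive factor by the equation of the critical point. *)
Lemma gamma_inj theta theta' : gamma theta = gamma theta' -> expi theta = expi theta' :> C.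
Proof.
move=> e.
have [] := @gamma_exposed theta _ (expi theta') (zeta_le1 theta') _ _.
- by rewrite cabs_expi.
- by rewrite e.
move=> ze zi; have [tx [c1|[_ /zi]]] // := t_spec theta.
have [tx' _] := t_spec theta'.
have hx := lt_le_trans eta_lt tx; have hx' := lt_le_trans eta_lt tx'.
have eq1 := crit_eq theta hx; have eq2 := crit_eq theta' hx'.
rewrite -!zetaE ze in eq1 eq2.
set x := t_ eta t theta in hx eq1; set x' := t_ eta t theta' in hx' eq2.
set z := zeta_ eta t theta in eq1 eq2 c1.
have x0 : 0 < x by move: eta_lt (cabs_ge0 eta); lra.
have x0' : 0 < x' by move: eta_lt (cabs_ge0 eta); lra.
set Q := 1 - _ in eq1 eq2.
have Q0 : Q != 0.
  apply/eqP => Q0; move/(congr1 (@cabs R)): eq1.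
  rewrite Q0 mulr0 cabs0 cabsM c1 cabs_ofR mulr1 ger0_norm; lra.
have eq3 : x'%:C * expi theta = x%:C * expi theta'.
  apply: (mulIf Q0); rewrite -!mulrA eq1 eq2 !ofRE; ring.
have xx : x' = x.
  by have := congr1 (@cabs R) eq3; rewrite !cabsM !cabs_expi !mulr1 !cabs_ofR !gtr0_norm.
move: eq3; rewrite xx => /mulfI; apply; by rewrite ofR_eq0 gt_eqF.
Qed.

Lemma c_continuous : continuous (c eta).
Proof.
move=> z; rewrite /c.
have c1 : (fun w => 1 - eta * w) @ z --> 1 - eta * z.
  apply: (@cvgB C C C (nbhs z) _ (fun=> 1) (fun w => eta * w) 1 (eta * z) (cvg_cst _)).
  exact: (@cvgMr C C (nbhs z) _ id eta z cvg_id).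
exact: (@cvgM C C (nbhs z) _ id (fun w => 1 - eta * w) z _ cvg_id c1).
Qed.

Lemma rho_continuous : continuous (fun z => (rho t z)%:C : C).
Proof.
move=> z; have h : rho t w @[w --> z] --> rho t z.
  apply: (@cvgMr R C (nbhs z) _ _ t (1 - cabs z ^+ 2)).
  apply: (@cvgB R R C (nbhs z) _ (fun=> 1) (fun w => cabs w ^+ 2) _ _ (cvg_cst _)).
  exact: (cvg_comp _ (fun x : R => x ^+ 2) (@cabs_continuous R z) (@exprn_continuous R 2 _)).
exact: (cvg_comp _ _ h (@ofR_continuous R _)).
Qed.

Lemma gamma_continuous : continuous gamma.
Proof.
move=> x; have hz := @zeta_continuous x.
have c1 := cvg_comp _ _ hz (@c_continuous _).
have c2 := cvg_comp _ _ hz (@rho_continuous _).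
exact: (@cvgD C C R (nbhs x) _ _ _ _ _ c1 (@cvgM C R (nbhs x) _ _ _ _ _ c2 (@expi_continuous R x))).
Qed.

Lemma gamma_expi theta theta' : expi theta = expi theta' :> C -> gamma theta = gamma theta'.
Proof. by move=> e; rewrite /gamma /zeta_ /t_ e. Qed.

End Extremal.

(** * Compact convex sets of the plane *)

Section PlaneConvex.
Variable R : realType.
Local Notation C := (Cplx R).
Implicit Types (A K : set C) (p q w z : C).

(** The real scalar product of the plane. *)
Definition dot z w : R := re (cconj z * w).

Lemma dotBr z p q : dot z (p - q) = dot z p - dot z q.
Proof. by rewrite /dot mulrBr reD reN. Qed.

Lemma dotZl (a : R) z w : dot (a%:C * z) w = a * dot z w.
Proof. by rewrite /dot !reimE; ring. Qed.

Lemma dot_sqr z : dot z z = cabs z ^+ 2.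
Proof. by rewrite /dot mulrC mul_conj. Qed.

Lemma dot_le z w : dot z w <= cabs z * cabs w.
Proof. by rewrite /dot -(cabs_conj z) -cabsM; exact: re_le_cabs. Qed.

Lemma real_convex_convex A : real_convex A -> convex_set A.
Proof.
move=> hA x y k; rewrite !inE => Ax Ay.
have [e e0 ke] := ge_ofR0 (ge0 k).
have e1 : e <= 1 by rewrite -le_ofR -ke; exact: le1.
have := hA x y e Ax Ay; rewrite e0 e1 => /(_ isT).
by rewrite ofRB -ke.
Qed.

Lemma closed_compact K : compact K -> closed K.
Proof. by apply: compact_closed; exact: norm_hausdorff. Qed.

(** The direction is that from the nearest point n of K to q: moving from n
    towards w in K does not decrease the distance to q. *)
Lemma separation K q : compact K -> real_convex K -> K !=set0 -> ~ K q ->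
  exists2 d : C, d != 0 & forall w, K w -> dot d w < dot d q.
Proof.
move=> Kc Kv [w0 Kw0] Kq.
have [||n Kn nmin] := compact_EVT_min _ Kc (f := fun w => cabs (q - w)).
- by exists w0.
- apply: continuous_subspaceT => w.
  exact: (cvg_comp _ _ (@cvgB C C C (nbhs w) _ (fun=> q) id q w (cvg_cst _) cvg_id)
    (@cabs_continuous R _)).
rewrite inE in Kn.
have d0 : q - n != 0 by rewrite subr_eq0; apply/eqP => e; apply: Kq; rewrite e.
exists (q - n) => // w Kw.
have cd0 : 0 < cabs (q - n) by rewrite cabs_gt0.
suff : dot (q - n) (w - n) <= 0.
  have := dot_sqr (q - n); rewrite !dotBr; have := exprn_gt0 2 cd0; lra.
rewrite leNgt; apply/negP => a0; set a := dot _ _ in a0.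
set m := cabs (w - n) ^+ 2; have m0 : 0 <= m by exact: sqr_ge0.
(* The weight that minimizes the distance to q along the segment, up to the
   summand a which keeps it below 1. *)
pose e := a / (a + m).
have am : 0 < a + m by lra.
have e0 : 0 < e by rewrite divr_gt0.
have e1 : e <= 1 by rewrite ler_pdivrMr //; lra.
have := nmin (e%:C * w + (1 - e)%:C * n).
rewrite inE => /(_ (Kv _ _ _ Kw Kn _)); rewrite (ltW e0) e1 => /(_ isT).
have -> : q - (e%:C * w + (1 - e)%:C * n) = (q - n) - e%:C * (w - n).
  by rewrite ofRB ofR1; ring.
rewrite -(@ler_pXn2r _ 2) ?nnegrE ?cabs_ge0 //.
have -> : cabs (q - n - e%:C * (w - n)) ^+ 2 = cabs (q - n) ^+ 2 - 2 * e * a + e ^+ 2 * m.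
  by rewrite /a /m /dot !cabs_sqr !reimE; ring.
have ee : e * (a + m) = a by rewrite divfK // gt_eqF.
have : e * (e * m) < e * a by rewrite ltr_pM2l //; nra.
nra.
Qed.

Lemma real_convex_interior A : real_convex A -> real_convex (interior A).
Proof.
move=> hA x y t /nbhs_cabs[e e0 He] /nbhs_cabs[e' e0' He'] t01.
apply/nbhs_cabs; exists (Num.min e e'); first by rewrite lt_min e0 e0'.
move=> w; rewrite lt_min => /andP[w1 w2].
set z := t%:C * x + _ in w1 w2.
have -> : w = t%:C * (x + (w - z)) + (1 - t)%:C * (y + (w - z)).
  by rewrite /z ofRB ofR1; ring.
apply: hA => //; [apply: He|apply: He']; by rewrite addrAC subrr add0r.
Qed.

(** A point of K is the limit of points of the segment that joins it to an
    interior point; around these there are balls contained in K, by homothety.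
    *)
Lemma real_convex_closure K : closed K -> real_convex K -> interior K !=set0 ->
  K = closure (interior K).
Proof.
move=> Kcl Kv [p0 /nbhs_cabs[e e0 He]]; apply/seteqP; split; last first.
  move=> z hz; rewrite [K](closure_id K).1 //; move: hz; apply: closure_subset.
  exact: interior_subset.
move=> p Kp A /nbhs_cabs[d d0 Hd].
pose t := Num.min 1 (d / (cabs (p0 - p) + 1)).
have D0 : 0 < cabs (p0 - p) + 1 by have := cabs_ge0 (p0 - p); lra.
have t0 : 0 < t by rewrite lt_min ltr01 divr_gt0.
have t1 : t <= 1 by rewrite /t ge_min lexx.
have td : t * (cabs (p0 - p) + 1) <= d by rewrite -ler_pdivlMr // /t ge_min lexx orbT.
exists (t%:C * p0 + (1 - t)%:C * p); split.
  apply/nbhs_cabs; exists (t * e); first by rewrite mulr_gt0.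
  set z := t%:C * p0 + _ => w wz.
  have tn : t%:C != 0 :> C by rewrite ofR_eq0 gt_eqF.
  have -> : w = t%:C * (p0 + (w - z) / t%:C) + (1 - t)%:C * p.
    rewrite /z ofRB ofR1; field; exact: tn.
  apply: Kv => //; last by rewrite (ltW t0).
  apply: He; rewrite addrAC subrr add0r cabsM cabsV cabs_ofR gtr0_norm //.
  by rewrite ltr_pdivrMr // mulrC.
apply: Hd; rewrite (_ : _ - p = t%:C * (p0 - p)); last by rewrite ofRB ofR1; ring.
by rewrite cabsM cabs_ofR gtr0_norm //; lra.
Qed.

Lemma bounded_cabsP A : bounded_set A <-> exists m : R, forall z, A z -> cabs z <= m.
Proof.
split=> [[M [Mr H]]|[m Hm]].
  have HM := H (M + 1) _; have [->|/set0P[z0 Az0]] := eqVneq A set0; first by exists 0.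
  have M1 : M < M + 1 by rewrite ltrDl.
  have h0 := HM M1 z0 Az0.
  have [m m0 me] := ge_ofR0 (le_trans (normr_ge0 _) h0).
  by exists m => z Az; have := HM M1 z Az; rewrite /= cabsE me le_ofR.
exists m%:C; split; first by rewrite complex_real.
move=> M mM z Az /=; apply: le_trans (ltW mM); rewrite cabsE le_ofR; exact: Hm.
Qed.

Lemma compact_cabs_bounded K : compact K -> exists m : R, forall z, K z -> cabs z <= m.
Proof.
move=> Kc; have [->|/set0P K0] := eqVneq K set0; first by exists 0.
have [|n _ nmax] := compact_EVT_max K0 Kc (f := fun w => cabs w).
  by apply: continuous_subspaceT; exact: cabs_continuous.
by exists (cabs n) => z Kz; apply: nmax; rewrite inE.
Qed.

(** A component of the complement of the boundary that meets the interior
    stays inside, so it is bounded.  From a point outside K, a half-line in a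
    separating direction never meets K, so the component is unbounded. *)
Lemma convex_enclosed K : compact K -> real_convex K -> interior K !=set0 ->
  K = boundary K `|` inside (boundary K).
Proof.
move=> Kc Kv Ki; have Kcl := closed_compact Kc.
have bE : boundary K = K `\` interior K by rewrite /boundary -(closure_id K).1.
have K0 : K !=set0 by case: Ki => p /interior_subset ?; exists p.
apply/seteqP; split => [p Kp|p [|[nb bd]]].
- have [|nb] := pselect (boundary K p); [by left|right; split => //].
  set S := connected_component _ p.
  have [m Hm] := compact_cabs_bounded Kc.
  apply/bounded_cabsP; exists m => z Sz; apply: Hm.
  suff SK : S `&` interior K = S by move: Sz; rewrite -SK => -[_ /interior_subset].
  have SJ z' : S z' -> ~ boundary K z' by apply: connected_component_sub.
  apply: component_connected.
  + exists p; split; first by apply: connected_component_refl.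
    by apply: contrapT => ni; apply: nb; rewrite bE.
  + by exists (interior K) => //; exact: open_interior.
  exists K => //; apply/seteqP; split => [z' [? /interior_subset //]|z' [Sz' Kz']].
  split => //; apply: contrapT => ni; apply: (SJ z' Sz'); by rewrite bE.
- by rewrite bE => -[].
apply: contrapT => Kp; have [d d0 Hd] := separation Kc Kv K0 Kp.
have cd : 0 < cabs d by rewrite cabs_gt0.
pose S : set C := [set p + x%:C * d | x in [set x : R | 0 <= x]].
have SK : S `<=` ~` boundary K.
  move=> _ [x /= x0 <-]; rewrite bE => -[/Hd h _]; move: h.
  rewrite /dot mulrDr reD mulrCA [cconj d * d]mulrC mul_conj -ofRM re_ofR.
  have : 0 <= x * cabs d ^+ 2 by rewrite mulr_ge0 // sqr_ge0.
  lra.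
have Sc : connected S.
  apply: real_convex_connected => _ _ t [x /= x0 <-] [y /= y0 <-] /andP[t0 t1].
  exists (t * x + (1 - t) * y); last by rewrite !ofRE; ring.
  by rewrite /= addr_ge0 // mulr_ge0 //; lra.
have Sp : S p by exists 0; rewrite /= ?mul0r ?addr0.
move/bounded_cabsP : bd => [m Hm].
have m0 : 0 <= m by apply: le_trans (Hm p _); rewrite ?cabs_ge0 //; exact: connected_component_refl.
(* A point of the half-line of modulus larger than m. *)
pose x := (m + cabs p + 1) / cabs d.
have x0 : 0 <= x by rewrite divr_ge0 ?(ltW cd) //; have := cabs_ge0 p; lra.
have := Hm (p + x%:C * d) _.
have Sx : connected_component (~` boundary K) p (p + x%:C * d).
  by apply: (connected_component_max Sp SK Sc); exists x.
move=> /(_ Sx); have := cabs_subr (x%:C * d) p.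
rewrite cabsM cabs_ofR ger0_norm // /x divfK ?gt_eqF // [_ + p]addrC; lra.
Qed.

Lemma convex_closed_domain K : compact K -> real_convex K -> interior K !=set0 ->
  closed_domain K.
Proof.
move=> Kc Kv Ki; exists (interior K); split => //.
- exact: open_interior.
- exact: real_convex_connected (real_convex_interior Kv).
- exact: real_convex_closure (closed_compact Kc) Kv Ki.
Qed.

End PlaneConvex.

(** * Convex sets bounded by a curve of exposed points *)

Section ExposedCurve.
Variables (R : realType) (K : set (Cplx R)) (gam : R -> Cplx R) (kap : Cplx R).
Local Notation C := (Cplx R).
Implicit Types (theta : R) (p q : C).
Hypotheses (Kc : compact K) (Kv : real_convex K) (kap0 : kap != 0).
Hypotheses (gK : forall theta, K (gam theta)) (gcont : continuous gam).
Hypothesis gsupp : forall theta p, K p ->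
  dot (kap * expi theta) p <= dot (kap * expi theta) (gam theta).
Hypothesis gexp : forall theta p, K p ->
  dot (kap * expi theta) (gam theta) <= dot (kap * expi theta) p -> p = gam theta.
Hypothesis ginj : forall theta theta', gam theta = gam theta' ->
  expi theta = expi theta' :> C.
Hypothesis gper : forall theta theta', expi theta = expi theta' :> C ->
  gam theta = gam theta'.

(** Points slightly further in the direction of exposure are not in K. *)
Lemma boundary_curve theta : boundary K (gam theta).
Proof.
split; first exact: subset_closure.
move=> /nbhs_cabs[e e0 He].
have ck : 0 < cabs kap by rewrite cabs_gt0.
pose x := e / 2 / cabs kap; have x0 : 0 < x by rewrite !divr_gt0.
pose q := gam theta + x%:C * (kap * expi theta).
have Kq : K q.
  apply: He; rewrite addrAC subrr add0r !cabsM cabs_expi mulr1 cabs_ofR gtr0_norm //.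
  by rewrite divfK ?gt_eqF //; lra.
have := gsupp theta Kq; rewrite -subr_le0 -dotBr /q addrAC subrr add0r.
rewrite /dot mulrCA mulrC [_ * (kap * _)]mulrC mul_conj -ofRM re_ofR.
rewrite cabsM cabs_expi mulr1; apply/negP; rewrite -ltNge mulr_gt0 // exprn_gt0 //.
Qed.

(** The gap between the support function and the value at p is continuous in
    the direction, so it has a minimum.  If the minimum is positive, no point
    near p can be separated from K, and p is an interior point; so p is an
    exposed point. *)
Lemma boundary_subset_curve p : boundary K p -> exists2 theta, - pi < theta <= pi & gam theta = p.
Proof.
move=> [/= clp nip]; have Kp : K p by rewrite [K](closure_id K).1 //; exact: closed_compact.
pose F theta := dot (kap * expi theta) (gam theta - p).
have Fc : continuous F.
  move=> x.
  have c1 := @cvgMr C R (nbhs x) (nbhs_filter x) _ kap _ (@expi_continuous R x).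
  have c2 := cvg_comp _ _ c1 (@cconj_continuous R _).
  have c3 := @cvgB C C R (nbhs x) (nbhs_filter x) gam (fun=> p) _ _ (@gcont x) (@cvg_cst _ p _ _ (nbhs_filter x)).
  have c4 := @cvgM C R (nbhs x) (nbhs_filter x) _ _ _ _ c2 c3.
  have c5 := cvg_comp _ _ c4 (@re_continuous R _).
  exact: c5.
have pi0 : - pi <= pi :> R by have := pi_gt0 R; lra.
have [x xI xmin] := @EVT_min R F (- pi) pi pi0 (continuous_subspaceT Fc).
have F0 theta : 0 <= F theta by rewrite /F dotBr subr_ge0; exact: gsupp.
have Fx0 : F x = 0.
  apply/eqP; rewrite eq_le F0 andbT leNgt; apply/negP => Fx.
  have ck : 0 < cabs kap by rewrite cabs_gt0.
  apply: nip; apply/nbhs_cabs; exists (F x / cabs kap); first by rewrite divr_gt0.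
  move=> q; rewrite ltr_pdivlMr // => qp; apply: contrapT => Kq.
  have [d d0 Hd] := separation Kc Kv (ex_intro _ _ Kp) Kq.
  have cd : 0 < cabs d by rewrite cabs_gt0.
  (* The angle for which kap e^(i theta) is a positive multiple of d. *)
have [|theta th e] := @expi_surj R (d / kap * (cabs kap / cabs d)%:C).
    rewrite !cabsM cabsV cabs_ofR ger0_norm ?divr_ge0 ?cabs_ge0 //.
    by field; rewrite !gt_eqF.
  have dE : kap * expi theta = (cabs kap / cabs d)%:C * d.
    by rewrite -e; field; exact: kap0.
  have c0 : 0 < cabs kap / cabs d by rewrite divr_gt0.
  have : F theta < F x; last first.
    apply/negP; rewrite -leNgt; apply: xmin; rewrite in_itv /=.
    by case/andP: th => /ltW -> ->.
  apply: le_lt_trans qp.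
  apply: le_trans (_ : dot (kap * expi theta) (q - p) <= _); last first.
    by apply: le_trans (dot_le _ _) _; rewrite cabsM cabs_expi mulr1 mulrC.
  rewrite /F !dotBr lerD2r dE !dotZl ler_wpM2l ?(ltW c0) // ltW //; exact: Hd.
have pg : p = gam x.
  by apply: gexp => //; rewrite -subr_le0 -dotBr -/(F x) Fx0.
move: xI; rewrite in_itv /= => /andP[]; rewrite le_eqVlt => /orP[/eqP e _|x1 x2].
  exists pi; first by rewrite lexx andbT; have := pi_gt0 R; lra.
  by rewrite pg -e; apply: gper; rewrite expi_pi.
by exists x; rewrite ?x1 ?x2.
Qed.

Lemma boundary_parametrized : parametric_representation gam (boundary K).
Proof.
split; first exact: continuous_subspaceT.
split.
- by move=> theta _; exact: boundary_curve.
- move=> x y; rewrite !inE /= !in_itv /= => hx hy /ginj; exact: expi_inj.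
- by move=> p /boundary_subset_curve[x hx <-]; exists x => //; rewrite /= in_itv.
Qed.

(** The circle of directions is run through backwards, so that the end
    excluded from the injectivity interval of a Jordan curve matches the end
    excluded from the range of the principal argument. *)
Lemma boundary_jordan : jordan_curve (boundary K).
Proof.
have pi0 := pi_gt0 R.
pose g (u : R) := gam (pi - 2 * pi * u).
have gc : continuous g.
  move=> u; have c : pi - 2 * pi * x @[x --> u] --> pi - 2 * pi * u.
    by apply: cvgB; [exact: cvg_cst|apply: cvgMr; exact: cvg_id].
  exact: (cvg_comp _ _ c (@gcont _)).
exists g; split.
- exact: continuous_subspaceT.
- rewrite /g mulr0 subr0 mulr1; apply: gper.
  by rewrite -expi_pi; congr expi; ring.
- move=> u v; rewrite !in_itv /= => /andP[u0 u1] /andP[v0 v1] /ginj/expi_inj e.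
  have : pi - 2 * pi * u = pi - 2 * pi * v.
    by apply: e; apply/andP; split; nra.
  move=> /addrI/oppr_inj/mulfI; apply; lra.
apply/seteqP; split => [p|_ [u _ <-]]; last exact: boundary_curve.
move=> /boundary_subset_curve[x /andP[x1 x2] <-].
exists ((pi - x) / (2 * pi)).
  rewrite /= in_itv /=; apply/andP; split; first by rewrite divr_ge0 //; lra.
  by rewrite ler_pdivrMr ?mul1r //; lra.
by rewrite /g; congr gam; field; lra.
Qed.

End ExposedCurve.

(** * The boundary curve of the set of third derivatives *)

Section Assembly.
Variables (R : realType) (r s : R) (lambda : Cplx R).
Hypotheses (s0 : 0 <= s) (sr : s < r) (r1 : r < 1) (cl1 : cabs lambda < 1).
Local Notation C := (Cplx R).
Local Notation A := (constA r s).
Local Notation B := (constB r s lambda).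
Local Notation K := (constC r s lambda).
Local Notation eta := (const_eta r s lambda).
Local Notation t := (const_t r s lambda).
Local Notation vpt := (value r s lambda).
Local Notation V := (V r s lambda).
Implicit Types (theta : R) (p w zeta : C).

Let et : cabs eta < t := eta_lt_t s0 sr r1 cl1.
Let t_gt0 : 0 < t := const_t_gt0 s0 sr r1 cl1.
Let K0 : K != 0 := constC_neq0 s0 sr r1 cl1.
Let A0 : A != 0 := constA_neq0 s0 sr r1.

Definition curve theta : C := vpt (zeta_ eta t theta) (expi theta).

Lemma curveE theta : curve theta = A * (B + K * gamma eta t theta).
Proof. by []. Qed.

Let a := 6 * (r ^+ 2 - s ^+ 2) / (r ^+ 3 * (1 - r ^+ 2) ^+ 3).
Let a_gt0 : 0 < a := constA_gt0 s0 sr r1.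

(** Multiplication by A > 0 and by C turns the direction theta into the
    direction C e^(i theta). *)
Lemma dot_affine theta (x : C) : dot (K * expi theta) (A * (B + K * x)) =
  a * dot (K * expi theta) B + a * cabs K ^+ 2 * re (cconj (expi theta) * x).
Proof.
have -> : A = a%:C by [].
rewrite cabs_sqr /dot; set k := K; rewrite !reimE; ring.
Qed.

Lemma curve_support_le theta zeta w : cabs zeta <= 1 -> cabs w <= 1 ->
  dot (K * expi theta) (vpt zeta w) <= dot (K * expi theta) (curve theta).
Proof.
move=> z1 w1; rewrite curveE !dot_affine lerD2l ler_wpM2l //.
  by rewrite mulr_ge0 ?(ltW a_gt0) // sqr_ge0.
exact: gamma_support.
Qed.

Lemma curve_support_eq theta zeta w : cabs zeta <= 1 -> cabs w <= 1 ->
  dot (K * expi theta) (curve theta) <= dot (K * expi theta) (vpt zeta w) ->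
  zeta = zeta_ eta t theta /\ (cabs (zeta_ eta t theta) < 1 -> w = expi theta).
Proof.
move=> z1 w1; rewrite curveE !dot_affine lerD2l ler_pM2l; last first.
  by rewrite mulr_gt0 // exprn_gt0 // cabs_gt0.
exact: gamma_exposed.
Qed.

Lemma curve_exposed theta : exposed r s lambda (zeta_ eta t theta) (expi theta).
Proof.
by move=> zeta w z1 w1 e; apply: curve_support_eq => //; rewrite e.
Qed.

Lemma rho1 zeta : cabs zeta = 1 -> rho t zeta = 0.
Proof. by move=> z1; rewrite /rho z1 expr1n subrr mulr0. Qed.

Lemma value_unit zeta w : cabs zeta = 1 -> vpt zeta w = A * (B + K * c eta zeta).
Proof. by move=> z1; rewrite /value rho1 // ofR0 mul0r addr0. Qed.

Lemma zeta_cases theta : cabs (zeta_ eta t theta) < 1 \/ cabs (zeta_ eta t theta) = 1.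
Proof.
have := zeta_le1 et theta; rewrite le_eqVlt => /orP[/eqP|]; [by right|by left].
Qed.

Lemma curve_unique theta p : V p ->
  dot (K * expi theta) (curve theta) <= dot (K * expi theta) p -> p = curve theta.
Proof.
rewrite V_values // => -[zeta [w [z1 w1 ->]]] /curve_support_eq[//|//|ze zw].
have [/zw we|z1'] := zeta_cases theta; first by rewrite /curve -ze we.
by rewrite /curve ze !value_unit.
Qed.

Lemma V_curve theta : V (curve theta).
Proof.
rewrite V_values //; exists (zeta_ eta t theta), (expi theta).
by rewrite cabs_expi (zeta_le1 et).
Qed.

Lemma V_support theta p : V p -> dot (K * expi theta) p <= dot (K * expi theta) (curve theta).
Proof. by rewrite V_values // => -[zeta [w [z1 w1 ->]]]; exact: curve_support_le. Qed.

(** For weights x + y = 1, replacing two parameters by their mean shifts the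
    centre by eta x y (z - z')^2, whereas the radius increases by t x y |z -
    z'|^2, which is larger. *)
Lemma V_real_convex : real_convex V.
Proof.
move=> p q; rewrite V_values // => x [z [w [z1 w1 ->]]] [z' [w' [z1' w1' ->]]] /andP[x0 x1].
pose y := 1 - x; have y0 : 0 <= y by rewrite /y; lra.
pose m : C := x%:C * z + y%:C * z'.
have xy : x%:C + y%:C = 1 :> C by rewrite -ofRD /y addrC subrK.
have m1 : cabs m <= 1.
  apply: le_trans (cabsD _ _) _; rewrite !cabsM !cabs_ofR !ger0_norm //.
  have : x * cabs z <= x * 1 by rewrite ler_wpM2l.
  have : y * cabs z' <= y * 1 by rewrite ler_wpM2l.
  by rewrite /y; lra.
pose S : C := x%:C * (c eta z + (rho t z)%:C * w) + y%:C * (c eta z' + (rho t z')%:C * w').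
have SE : S - c eta m = - (eta * (x * y)%:C * (z - z') ^+ 2) +
    (x * rho t z)%:C * w + (y * rho t z')%:C * w'.
  have xE : x%:C = 1 - y%:C :> C by rewrite -xy addrK.
  by rewrite /S /m /c !ofRM xE; ring.
have rE : rho t m = x * rho t z + y * rho t z' + t * (x * y) * cabs (z - z') ^+ 2.
  by rewrite /rho !cabs_sqr !reimE /y; ring.
have dl : cabs (S - c eta m) <= rho t m.
  have r0 := rho_ge0 et z1; have r0' := rho_ge0 et z1'.
  have cD : cabs ((z - z') ^+ 2) = cabs (z - z') ^+ 2 by exact: cabsX.
  rewrite SE rE -cD; set d := (z - z') ^+ 2 in cD *.
  apply: le_trans (cabsD _ _) _; apply: le_trans (lerD (cabsD _ _) (lexx _)) _.
  have n1 : cabs (- (eta * (x * y)%:C * d)) = cabs eta * (x * y) * cabs d.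
    by rewrite cabsN (cabsM (eta * _)) (cabsM eta) cabs_ofR ger0_norm ?mulr_ge0.
  have n2 : cabs ((x * rho t z)%:C * w) = x * rho t z * cabs w.
    by rewrite (cabsM _ w) cabs_ofR ger0_norm // mulr_ge0.
  have n3 : cabs ((y * rho t z')%:C * w') = y * rho t z' * cabs w'.
    by rewrite (cabsM _ w') cabs_ofR ger0_norm // mulr_ge0.
  rewrite n1 n2 n3.
  have : x * rho t z * cabs w <= x * rho t z by rewrite ler_piMr // mulr_ge0.
  have : y * rho t z' * cabs w' <= y * rho t z' by rewrite ler_piMr // mulr_ge0.
  have : cabs eta * (x * y) * cabs d <= t * (x * y) * cabs d.
    apply: ler_wpM2r; first exact: cabs_ge0.
    by apply: ler_wpM2r; [exact: mulr_ge0|exact: ltW].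
  lra.
have [w2 w21 Sw] : exists2 w2 : C, cabs w2 <= 1 & S = c eta m + (rho t m)%:C * w2.
  have rm := le_trans (cabs_ge0 _) dl.
  have [e|rn] := eqVneq (rho t m) 0.
    exists 0; first by rewrite cabs0.
    rewrite mulr0 addr0; apply/eqP; rewrite -subr_eq0 -cabs_eq0 eq_le cabs_ge0 andbT.
    by rewrite -e.
  exists ((S - c eta m) / (rho t m)%:C).
    rewrite cabsM cabsV cabs_ofR ger0_norm // ler_pdivrMr ?mul1r // lt0r rn //.
  by rewrite mulrC divfK ?ofR_eq0 // addrC subrK.
exists m, w2; split => //.
rewrite /value -Sw /S -/y.
have -> : y%:C = 1 - x%:C by rewrite -xy addrAC subrr add0r.
ring.
Qed.

Lemma affine_continuous (T : topologicalType) (g : T -> C) :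
  continuous g -> continuous (fun u => A * (B + K * g u)).
Proof.
move=> gc u; have c1 := @cvgMr C T (nbhs u) (nbhs_filter u) _ K _ (gc u).
have c2 := @cvgD C C T (nbhs u) (nbhs_filter u) (fun=> B) _ _ _
  (@cvg_cst _ B _ _ (nbhs_filter u)) c1.
exact: (@cvgMr C T (nbhs u) (nbhs_filter u) _ A _ c2).
Qed.

Lemma V_compact : compact V.
Proof.
have -> : V = (fun u : C * C => vpt u.1 u.2) @`
    ([set z | cabs z <= 1] `*` [set z | cabs z <= 1]).
  rewrite V_values //; apply/seteqP; split => [_ [z [w [z1 w1 ->]]]|_ [[z w] [/= z1 w1] <-]].
    by exists (z, w).
  by exists z, w.
apply: continuous_compact; last by apply: compact_setX; exact: compact_cdisk.
apply: continuous_subspaceT.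
apply: affine_continuous => u.
have F := nbhs_filter u; have F2 := nbhs_filter u.2.
have c1 := cvg_comp _ _ (@cvg_fst _ _ (nbhs u.1) (nbhs u.2) F2) (@c_continuous R eta u.1).
have c2 := cvg_comp _ _ (@cvg_fst _ _ (nbhs u.1) (nbhs u.2) F2) (@rho_continuous R t u.1).
have F1 := nbhs_filter u.1.
have c3 := @cvgM C _ (nbhs u) F _ _ _ _ c2 (@cvg_snd _ _ (nbhs u.1) (nbhs u.2) F1).
exact: (@cvgD C C _ (nbhs u) F _ _ _ _ c1 c3).
Qed.

(** The disk of values for zeta = 0 is a disk of positive radius. *)
Lemma V_interior : interior V !=set0.
Proof.
pose k : C := A * K * t%:C.
have t0 : t%:C != 0 :> C by rewrite ofR_eq0 gt_eqF.
have k0 : k != 0 := mulf_neq0 (mulf_neq0 A0 K0) t0.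
exists (A * B); apply/nbhs_cabs; exists (cabs k); first by rewrite cabs_gt0.
move=> p pk; rewrite V_values //; exists 0, ((p - A * B) / k); split.
- by rewrite cabs0.
- by rewrite cabsM cabsV ler_pdivrMr ?cabs_gt0 // mul1r ltW.
rewrite /value /c /rho cabs0 expr0n subr0 mulr1 mul0r add0r /k.
move: (t%:C) (K) (A) t0 K0 A0 => x y z *; field.
by apply/and3P; split.
Qed.

Lemma curve_continuous : continuous curve.
Proof. exact: affine_continuous (@gamma_continuous R eta t et). Qed.

Lemma curve_inj theta theta' : curve theta = curve theta' -> expi theta = expi theta' :> C.
Proof. by rewrite !curveE => /(mulfI A0)/addrI/(mulfI K0); exact: gamma_inj. Qed.

Lemma curve_per theta theta' : expi theta = expi theta' :> C -> curve theta = curve theta'.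
Proof. by move=> e; rewrite !curveE (gamma_expi eta t e). Qed.

Lemma curve_boundary theta : boundary V (curve theta).
Proof. exact: boundary_curve K0 V_curve V_support theta. Qed.

Lemma curve_parametrizes : parametric_representation curve (boundary V).
Proof.
exact: boundary_parametrized V_compact V_real_convex K0 V_curve curve_continuous
  V_support curve_unique curve_inj curve_per.
Qed.

Lemma V_jordan : jordan_curve (boundary V).
Proof.
exact: boundary_jordan V_compact V_real_convex K0 V_curve curve_continuous
  V_support curve_unique curve_inj curve_per.
Qed.

End Assembly.

Theorem theorem4p1 (R : realType) (r s : R) (lambda : Cplx R)
    (s_ge0 : 0 <= s) (s_lt_r : s < r) (r_lt1 : r < 1)
    (lambda_lt1 : `|lambda| < 1) :
  let V := V r s lambda in
  let A := constA r s in
  let B := constB r s lambda in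
  let C := constC r s lambda in
  let eta := const_eta r s lambda in
  let t := const_t r s lambda in
  let zeta := zeta_ eta t in
  let gamma_bd (theta : R) : Cplx R := A * (B + C * c eta (zeta theta)) in
  let gamma_in (theta : R) : Cplx R :=
    A * (B + C * (c eta (zeta theta)
                  + (rho t (zeta theta))%:C * expi theta)) in
  [/\ [/\ convex_set V, closed_domain V, jordan_curve (boundary V)
        & enclosed_by V (boundary V)],
      (t + cabs eta <= 1 / 2 ->
         (forall theta : R,
            2 * (t ^+ 2 - cabs eta ^+ 2) <= cabs (t%:C * expi theta - cconj eta)
            /\ boundary V (gamma_bd theta))
         /\ parametric_representation gamma_bd (boundary V)),
      (1 / 2 <= t - cabs eta ->
         (forall theta : R,
            cabs (t%:C * expi theta - cconj eta) <= 2 * (t ^+ 2 - cabs eta ^+ 2)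
            /\ boundary V (gamma_in theta))
         /\ parametric_representation gamma_in (boundary V)),
      (1 / 2 < t + cabs eta -> t - cabs eta < 1 / 2 ->
         parametric_representation
           (fun theta : R =>
              if cabs (t%:C * expi theta - cconj eta)
                 < 2 * (t ^+ 2 - cabs eta ^+ 2)
              then gamma_in theta else gamma_bd theta)
           (boundary V))
    & forall f : Cplx R -> Cplx R, H0_at r s lambda f ->
        (forall theta : R, disk (zeta theta) ->
           ((f^`(3))%classic r%:C = gamma_in theta
            /\ boundary V (gamma_in theta))
           <-> (forall z : Cplx R, disk z ->
                  f z = z * T (s / r)%:C
                    (T (- r)%:C z * T lambda
                      (T (- r)%:C z * T (zeta theta)
                        (expi (theta + arg C) * T (- r)%:C z)))))
        /\ (forall theta : R, `|zeta theta| = 1 ->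
           ((f^`(3))%classic r%:C = gamma_bd theta
            /\ boundary V (gamma_bd theta))
           <-> (forall z : Cplx R, disk z ->
                  f z = z * T (s / r)%:C
                    (T (- r)%:C z * T lambda (zeta theta * T (- r)%:C z))))].
Proof.
have cl1 : cabs lambda < 1 by rewrite -diskE.
move=> V A B C eta t zeta gamma_bd gamma_in.
have et : cabs eta < t := eta_lt_t s_ge0 s_lt_r r_lt1 cl1.
have e0 := cabs_ge0 eta.
have bdE theta : cabs (zeta theta) = 1 -> gamma_bd theta = curve r s lambda theta.
  by move=> z1; rewrite /curve value_unit.
have outer theta : 2 * (t ^+ 2 - cabs eta ^+ 2) <= cabs (t%:C * expi theta - cconj eta) ->
    cabs (zeta theta) = 1.
  by move=> /(t_outer et)[].
have bd theta := curve_boundary s_ge0 s_lt_r r_lt1 cl1 theta.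
have par := curve_parametrizes s_ge0 s_lt_r r_lt1 cl1.
have Vc := V_compact s_ge0 s_lt_r r_lt1 cl1.
have Vs := V_real_convex s_ge0 s_lt_r r_lt1 cl1.
have Vi := V_interior s_ge0 s_lt_r r_lt1 cl1.
have te theta : cabs (t%:C * expi theta : Cplx R) = t.
  by rewrite cabsM cabs_expi mulr1 cabs_ofR ger0_norm //; lra.
split.
- split; [exact: real_convex_convex|exact: convex_closed_domain|
          exact: V_jordan|exact: convex_enclosed].
- move=> small.
  have out theta : 2 * (t ^+ 2 - cabs eta ^+ 2) <= cabs (t%:C * expi theta - cconj eta).
    have := cabs_subl (t%:C * expi theta) (cconj eta); rewrite te cabs_conj; nra.
  have bE : gamma_bd = curve r s lambda by apply/funext => theta; apply/bdE/outer.
  by rewrite bE; split.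
- move=> large; split => // theta; split => //.
  have := cabsD (t%:C * expi theta) (- cconj eta); rewrite te cabsN cabs_conj; nra.
- move=> _ _; rewrite (_ : (fun theta => _) = curve r s lambda) //.
  apply/funext => theta; case: ltP => [//|/outer]; exact: bdE.
move=> f Hf; split => theta.
  rewrite diskE => z1.
  have ex := extremal_interior s_ge0 s_lt_r r_lt1 cl1 Hf z1
    (@curve_exposed R r s lambda s_ge0 s_lt_r r_lt1 cl1 theta).
  split => [[/ex fE _] z zD|fE].
    by rewrite fE // /schur3 /schur2 /schur_tail [T (- r)%:C z * expi _]mulrC.
  split=> //; apply/ex => z zD.
  by rewrite fE // /schur3 /schur2 /schur_tail [T (- r)%:C z * expi _]mulrC.
rewrite cabsE -ofR1 => -[z1].
have ex := extremal_boundary s_ge0 s_lt_r r_lt1 cl1 Hf z1 (w := expi theta) _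
   (@curve_exposed R r s lambda s_ge0 s_lt_r r_lt1 cl1 theta).
rewrite bdE //; split => [[/ex fE _] z zD|fE].
  by rewrite fE ?cabs_expi // /schur3 /schur2 [T (- r)%:C z * zeta_ _ _ _]mulrC.
split=> //; apply/ex => [|z zD]; first by rewrite cabs_expi.
by rewrite fE // /schur3 /schur2 [T (- r)%:C z * zeta_ _ _ _]mulrC.
Qed.
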